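(* Let $n \geq 2$ and let $\langle\,,\,\rangle_0$ be a bi-invariant Riemannian metric on $\mathrm{SO}(2n)$. Then there exist a Riemannian metric on the sphere $\mathbf{S}^{2n-2}$ and a Riemannian submersion $$(\mathrm{SO}(2n), \langle\,,\,\rangle_0) \longrightarrow \mathbf{S}^{2n-2}.$$
   Context: All manifolds and maps are smooth. A Riemannian submersion $\pi:(M,g)\to(B,h)$ is a surjective smooth submersion such that, for every $p\in M$, the restriction of $d\pi_p$ to the $g$-orthogonal complement of $\ker d\pi_p$ is a linear isometry onto $T_{\pi(p)}B$. Riemannian submersions are always assumed to have connected fibers. The metric on the base is not prescribed: ''a Riemannian submersion onto $B$'' means a Riemannian submersion onto $B$ equipped with some Riemannian metric. *)

(* Defs.v *)
From HB Require Import structures.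
From mathcomp Require Import all_boot all_order all_algebra.
From mathcomp Require Import all_classical all_reals all_analysis.
Set Implicit Arguments.
Unset Strict Implicit.
Unset Printing Implicit Defensive.
Import Order.TTheory GRing.Theory Num.Theory.
Import numFieldNormedType.Exports.
Local Open Scope classical_set_scope.
Local Open Scope ring_scope.

(* Manifolds are embedded submanifolds of finite-dimensional normed spaces,
   given as subsets M : set V. A map between manifolds is a total function on
   the ambient spaces, of which only the restriction to M matters. *)

(* f is of class C^k on the open set U. Continuity of x |-> 'd f x v for each
   fixed v amounts to continuity of x |-> 'd f x because V is meant to be
   finite-dimensional; likewise for the higher derivatives. *)
Fixpoint Ck (R : realType) (V W : normedModType R) (k : nat) (U : set V)
    (f : V -> W) : Prop :=
  match k with
  | 0%N => forall x, U x -> {for x, continuous f}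
  | k'.+1 => (forall x, U x -> differentiable f x) /\
             forall v : V, Ck k' U (fun x => 'd f x v)
  end.

Definition smooth_near (R : realType) (V W : normedModType R)
    (x : V) (f : V -> W) : Prop :=
  exists U : set V, [/\ open U, U x & forall k, Ck k U f].

Definition local_extension (R : realType) (V W : normedModType R)
    (M : set V) (f : V -> W) (p : V) : set (V -> W) :=
  [set F | smooth_near p F /\ \forall x \near p, M x -> F x = f x].

Definition smooth_on (R : realType) (V W : normedModType R)
    (M : set V) (f : V -> W) : Prop :=
  forall p, M p -> local_extension M f p !=set0.

(* Velocities at p of smooth curves of M through p. *)
Definition tangent (R : realType) (V : normedModType R)
    (M : set V) (p : V) : set V :=
  [set v | exists c : R -> V,
     [/\ smooth_near (0 : R) c, \forall t \near (0 : R), M (c t), c 0 = p &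
         'd c (0 : R) (1 : R) = v]].

(* The differential at p of f : M -> W. Its values on [tangent M p], the only
   meaningful ones, do not depend on the local extension selected by xget. *)
Definition tangent_map (R : realType) (V W : normedModType R)
    (M : set V) (f : V -> W) (p : V) : V -> W :=
  'd (xget (cst 0) (local_extension M f p)) p.

Definition vector_field (R : realType) (V : normedModType R)
    (M : set V) (X : V -> V) : Prop :=
  smooth_on M X /\ forall p, M p -> tangent M p (X p).

(* The values of g p outside of [tangent M p] are irrelevant. *)
Record riemannian_metric (R : realType) (V : normedModType R)
    (M : set V) (g : V -> V -> V -> R) : Prop := RiemannianMetric {
  metric_sym : forall p u v, M p -> tangent M p u -> tangent M p v ->
    g p u v = g p v u ;
  metric_linear : forall p (a : R) u u' v, M p ->
    tangent M p u -> tangent M p u' -> tangent M p v ->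
    g p (a *: u + u') v = a * g p u v + g p u' v ;
  metric_pos : forall p u, M p -> tangent M p u -> u != 0 -> 0 < g p u u ;
  metric_smooth : forall X Y, vector_field M X -> vector_field M Y ->
    smooth_on M (fun p => g p (X p) (Y p))
}.

Definition horizontal (R : realType) (V W : normedModType R)
    (M : set V) (g : V -> V -> V -> R) (f : V -> W) (p : V) : set V :=
  [set u | tangent M p u /\
     forall v, tangent M p v -> tangent_map M f p v = 0 -> g p u v = 0].

(* Connectedness of the fibers is part of the definition. *)
Record riemannian_submersion (R : realType) (V W : normedModType R)
    (M : set V) (g : V -> V -> V -> R) (B : set W) (h : W -> W -> W -> R)
    (f : V -> W) : Prop := RiemannianSubmersion {
  rsub_fun : set_fun M B f ;
  rsub_smooth : smooth_on M f ;
  rsub_surj : set_surj M B f ;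
  rsub_submersion : forall p, M p ->
    set_surj (tangent M p) (tangent B (f p)) (tangent_map M f p) ;
  rsub_isometry : forall p u v, M p ->
    horizontal M g f p u -> horizontal M g f p v ->
    h (f p) (tangent_map M f p u) (tangent_map M f p v) = g p u v ;
  rsub_onto : forall p, M p ->
    set_surj (horizontal M g f p) (tangent B (f p)) (tangent_map M f p) ;
  rsub_connected : forall b, B b -> connected (M `&` f @^-1` [set b])
}.

Definition SO (R : realType) (N : nat) : set 'M[R]_N :=
  [set A | A *m A^T = 1%:M /\ \det A = 1].
Arguments SO R N : clear implicits.

(* The unit sphere S^m of R^(m+1). *)
Definition sphere (R : realType) (m : nat) : set 'rV[R]_m.+1 :=
  [set x | \sum_(i < m.+1) x 0 i ^+ 2 = 1].
Arguments sphere R m : clear implicits.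

Definition preserves_metric (R : realType) (V : normedModType R)
    (M : set V) (g : V -> V -> V -> R) (f : V -> V) : Prop :=
  forall p u v, M p -> tangent M p u -> tangent M p v ->
    g (f p) (tangent_map M f p u) (tangent_map M f p v) = g p u v.

Definition bi_invariant (R : realType) (N : nat)
    (g : 'M[R]_N -> 'M[R]_N -> 'M[R]_N -> R) : Prop :=
  forall A, SO R N A ->
    preserves_metric (SO R N) g (fun P => A *m P) /\
    preserves_metric (SO R N) g (fun P => P *m A).

(* Main.v *)
From HB Require Import structures.
Require Import Defs.
From mathcomp Require Import all_boot all_order all_fingroup all_algebra.
From mathcomp Require Import all_classical all_reals all_analysis.
From mathcomp Require Import ring lra zify.
Set Implicit Arguments.
Unset Strict Implicit.
Unset Printing Implicit Defensive.
Import Order.TTheory GRing.Theory Num.Theory.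
Import numFieldNormedType.Exports.
Local Open Scope classical_set_scope.
Local Open Scope ring_scope.

(* Let J be a complex structure on R^(2n), let e0 be the first basis vector, and put
   K(A) = A^T J A for A in SO(2n). As K(A) is skew and orthogonal, f(A) = K(A) e0 is a
   unit vector orthogonal to e0, that is, a point of S^(2n-2). Its differential is
   df(A Y) = [K, Y] e0 for Y skew. For w orthogonal to e0 and K e0, put
   M = w e0^T - e0 w^T; then [K, M] anticommutes with K and df(A [K, M]) = - 2 w.
   A bi-invariant metric is a constant multiple of the trace form on pairs of skew
   matrices one of which anticommutes with K (irreducibility of these matrices under
   U(n)), so <A [K, M], A Y> = - 2 k <w, [K, Y] e0>: the vectors A [K, M] are the
   horizontal ones, and f is a Riemannian submersion onto a round sphere.
   This also holds for n = 2, where the bi-invariant metric need not be a multiple of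
   the trace form on all skew matrices.
   The fiber of v is {A | A v = J A e0}. Unitary rotations on the left move A e0 to any
   unit vector, and two points of the fiber with the same u = A e0 differ by a rotation
   fixing u and J u, which is a product of pairs of reflections in vectors orthogonal to
   u and J u; each pair can be contracted. *)

(** * Invariant bilinear forms *)

Lemma skew_mxE (R : realType) n (X : 'M[R]_n) i j : X^T = - X -> X j i = - X i j.
Proof. by move=> /matrixP/(_ i j); rewrite !mxE. Qed.

Section OrthogonalInvariantForm.
Variables (R : realType) (n : nat) (b : 'M[R]_n -> 'M[R]_n -> R).
Hypothesis linear_l : forall a X X' Y, b (a *: X + X') Y = a * b X Y + b X' Y.
Hypothesis linear_r : forall a X Y Y', b X (a *: Y + Y') = a * b X Y + b X Y'.
Hypothesis invariant : forall O, O *m O^T = 1%:M ->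
  forall X Y, b (O *m X *m O^T) (O *m Y *m O^T) = b X Y.

Lemma biform0l Y : b 0 Y = 0.
Proof. by have := linear_l (-1) 0 0 Y; rewrite scaler0 addr0 mulN1r addNr. Qed.

Lemma biform0r X : b X 0 = 0.
Proof. by have := linear_r (-1) X 0 0; rewrite scaler0 addr0 mulN1r addNr. Qed.

Lemma biform_suml (I : finType) (c : I -> R) F Y :
  b (\sum_i c i *: F i) Y = \sum_i c i * b (F i) Y.
Proof.
elim/big_rec2: _ => [|i x X _ <-]; first exact: biform0l.
exact: linear_l.
Qed.

Lemma biform_sumr (I : finType) (c : I -> R) X F :
  b X (\sum_i c i *: F i) = \sum_i c i * b X (F i).
Proof.
elim/big_rec2: _ => [|i x Y _ <-]; first exact: biform0r.
exact: linear_r.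
Qed.

Lemma biformNl X Y : b (- X) Y = - b X Y.
Proof. by have := linear_l (-1) X 0 Y; rewrite biform0l !addr0 scaleN1r mulN1r. Qed.

Lemma biformNr X Y : b X (- Y) = - b X Y.
Proof. by have := linear_r (-1) X Y 0; rewrite biform0r !addr0 scaleN1r mulN1r. Qed.

Let E (j k : 'I_n) : 'M[R]_n := delta_mx j k - delta_mx k j.

Let EN j k : E k j = - E j k. Proof. by rewrite /E opprB. Qed.

Let E0 j : E j j = 0. Proof. by rewrite /E subrr. Qed.

Let skew_expand (X : 'M[R]_n) : X^T = - X ->
  X = \sum_(p : 'I_n * 'I_n) (2^-1 * X p.1 p.2) *: E p.1 p.2.
Proof.
move=> Xskew.
rewrite -(pair_bigA _ (fun i j => (2^-1 * X i j) *: E i j)) /=.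
under eq_bigr do under eq_bigr do rewrite scalerBr.
under eq_bigr do rewrite big_split /=.
rewrite big_split /= [X in _ + X]exchange_big /= -big_split /=.
rewrite {1}[X]matrix_sum_delta; apply: eq_bigr => i _.
rewrite -big_split /=; apply: eq_bigr => j _.
have -> : X j i = - X i j by exact: skew_mxE.
rewrite -scalerBl; congr (_ *: _); lra.
Qed.

(** Conjugation by a permutation matrix relabels the generators [E j k]. *)
Let b_perm (s : 'S_n) j k l m :
  b (E (s j) (s k)) (E (s l) (s m)) = b (E j k) (E l m).
Proof.
have Es x y : perm_mx s *m E (s x) (s y) *m (perm_mx s)^T = E x y.
  rewrite tr_perm_mx -row_permE -col_permE; apply/matrixP => u v.
  by rewrite !mxE !(inj_eq perm_inj).
rewrite -(Es j k) -(Es l m) invariant //.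
by rewrite tr_perm_mx -perm_mxM mulgV perm_mx1.
Qed.

(** Conjugation by the sign matrix that negates only the coordinate [j] changes the sign of [E j k]
    and fixes [E l m], so the value equals its own opposite. *)
Let b_flip j k l m : j != k -> j != l -> j != m -> b (E j k) (E l m) = 0.
Proof.
move=> jk jl jm.
pose d : 'rV[R]_n := \row_i (-1) ^+ (i == j).
have dT : (diag_mx d)^T = diag_mx d by rewrite tr_diag_mx.
have dd : diag_mx d *m (diag_mx d)^T = 1%:M.
  rewrite dT mulmx_diag -diag_const_mx; congr diag_mx.
  by apply/rowP => i; rewrite !mxE -expr2 sqrr_sign.
have d_delta x y : diag_mx d *m delta_mx x y *m (diag_mx d)^T =
    ((-1) ^+ (x == j) * (-1) ^+ (y == j)) *: delta_mx x y.
  rewrite dT; apply/matrixP => u v; rewrite mul_mx_diag mul_diag_mx !mxE.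
  by have [->|] := eqVneq u x; have [->|] := eqVneq v y => //=; rewrite ?(mulr0, mul0r, mulr1).
have dE x y : diag_mx d *m E x y *m (diag_mx d)^T =
    ((-1) ^+ (x == j) * (-1) ^+ (y == j)) *: E x y.
  by rewrite mulmxBr mulmxBl !d_delta scalerBr [X in _ - X *: _]mulrC.
have := invariant dd (E j k) (E l m).
rewrite !dE eqxx !(eq_sym _ j) (negbTE jk) (negbTE jl) (negbTE jm) !expr0 !mulr1 scale1r.
by rewrite expr1 scaleN1r biformNl => /eqP; rewrite eq_sym -addr_eq0 -mulr2n mulrn_eq0 => /eqP.
Qed.

(** Signed permutation matrices are enough: sign changes kill the values on pairs of generators with
    different index pairs, and permutations make all the values [b (E j k) (E j k)] with [j != k]
    equal. *)
Lemma orthogonal_invariant_form : exists k, forall X Y,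
  X^T = - X -> Y^T = - Y -> b X Y = k * \tr (X^T *m Y).
Proof.
suff [c bE] : exists c, forall j k l m, b (E j k) (E l m) =
    c * (((j == l) && (k == m))%:R - ((j == m) && (k == l))%:R).
  (* [skew_expand] sums over ordered pairs with weight 1/2 in each argument. The two pairs of [Y]
     that match a given pair of [X] contribute equally, so one factor 1/2 remains. *)
  exists (2^-1 * c) => X Y Xs Ys.
  rewrite (skew_expand Xs) biform_suml -(skew_expand Xs).
  under eq_bigr => p _ do rewrite (skew_expand Ys) biform_sumr -(skew_expand Ys).
  rewrite /mxtrace mulr_sumr.
  under [RHS]eq_bigr => i _ do rewrite mxE mulr_sumr.
  rewrite [RHS]exchange_big [RHS]pair_bigA /=.
  apply: eq_bigr => -[j k] _ /=.
  under eq_bigr => p _ do rewrite bE /= mulrBr mulrBr.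
  rewrite sumrB (bigD1 (j, k)) //= [X in _ - X](bigD1 (k, j)) //= !eqxx /=.
  rewrite !big1 => [|[l m]|[l m]] /=.
  - have -> : Y k j = - Y j k by exact: skew_mxE.
    rewrite mxE; lra.
  - by rewrite xpair_eqE (eq_sym j) (eq_sym k) => /negbTE; rewrite andbC => ->; rewrite !mulr0.
  - by rewrite xpair_eqE (eq_sym j) (eq_sym k) => /negbTE ->; rewrite !mulr0.
have b_trans j k j' k' : j != k -> j' != k' ->
    b (E j k) (E j k) = b (E j' k') (E j' k').
  (* The first transposition sends [j] to [j'] and [k] to [x]; the second sends [x] to [k'] and
     leaves [j'] in place. *)
  move=> jk jk'; pose x := tperm j j' k.
  have xj : x != j' by rewrite -(tpermL j j') /x (inj_eq perm_inj) eq_sym.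
  rewrite -(b_perm (tperm j j' * tperm x k')%g j k) !permM tpermL -/x tpermL.
  by rewrite tpermD // eq_sym.
have [[[j0 k0] /= jk0]|none] := pselect (exists p : 'I_n * 'I_n, p.1 != p.2); last first.
  exists 0 => j k l m; rewrite mul0r.
  have [->|jk] := eqVneq j k; first by rewrite E0 biform0l.
  by case: none; exists (j, k).
exists (b (E j0 k0) (E j0 k0)) => j k l m.
have [<-|jk] := eqVneq j k; first by rewrite E0 biform0l andbC subrr mulr0.
have [<-|lm] := eqVneq l m; first by rewrite E0 biform0r subrr mulr0.
have [jl|jl] := eqVneq j l; rewrite /=.
  subst l; rewrite (negbTE lm) /= subr0.
  have [<-|km] := eqVneq k m; first by rewrite mulr1; exact: b_trans.
  by rewrite mulr0 EN biformNl b_flip ?oppr0 // eq_sym.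
have [jm|jm] := eqVneq j m; rewrite /= sub0r; last by rewrite oppr0 mulr0 b_flip.
subst m; have [<-|kl] := eqVneq k l.
  by rewrite mulrN1 (EN j k) biformNr (b_trans j k j0 k0).
by rewrite oppr0 mulr0 EN biformNl b_flip ?oppr0 // eq_sym.
Qed.

End OrthogonalInvariantForm.

(** * Rotation-invariant forms and a complex structure *)

Section UnitaryInvariantForm.
Variables (R : realType) (n : nat).

Definition block_complex_structure : 'M[R]_(n + n) :=
  block_mx 0 1%:M (- 1%:M) 0.
Local Notation J := block_complex_structure.

Lemma block_complex_structureT : J^T = - J.
Proof. by rewrite tr_block_mx !trmx0 linearN /= trmx1 opp_block_mx !oppr0 opprK. Qed.

Lemma block_complex_structure_sqr : J *m J = - 1%:M.
Proof.
rewrite mulmx_block !mulmx0 !mul0mx !mul1mx mulmx1 !addr0 !add0r.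
by rewrite (scalar_mx_block n n 1) opp_block_mx !oppr0.
Qed.

Variable B : 'M[R]_(n + n) -> 'M[R]_(n + n) -> R.
Hypothesis linear_l : forall a X X' Y, B (a *: X + X') Y = a * B X Y + B X' Y.
Hypothesis symmetric : forall X Y, B X Y = B Y X.
Hypothesis invariant : forall O, O *m O^T = 1%:M -> \det O = 1 ->
  forall X Y, B (O *m X *m O^T) (O *m Y *m O^T) = B X Y.

Let linear_r a X Y Y' : B X (a *: Y + Y') = a * B X Y + B X Y'.
Proof. by rewrite symmetric linear_l !(symmetric X). Qed.

Let BNl := biformNl linear_l.
Let BNr := biformNr linear_r.

Let BBl X X' Y : B (X - X') Y = B X Y - B X' Y.
Proof. by rewrite addrC -scaleN1r linear_l mulN1r addrC. Qed.

Let BBr X Y Y' : B X (Y - Y') = B X Y - B X Y'.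
Proof. by rewrite symmetric BBl !(symmetric X). Qed.

Let half_double (Z : 'M[R]_(n + n)) : 2^-1 *: (Z + Z) = Z.
Proof. by rewrite scalerDr -scalerDl -div1r -splitr scale1r. Qed.

(** This is exp(pi J / 4), a square root of [J] in SO(2n). *)
Let rotation : 'M[R]_(n + n) := (Num.sqrt 2)^-1 *: (1%:M + J).

Let sqrt2V : (Num.sqrt 2 : R)^-1 * (Num.sqrt 2)^-1 = 2^-1.
Proof. by rewrite -invfM -expr2 sqr_sqrtr. Qed.

Let rotationT : rotation^T = (Num.sqrt 2)^-1 *: (1%:M - J).
Proof. by rewrite linearZ linearD /= trmx1 block_complex_structureT. Qed.

Let rotation_orthogonal : rotation *m rotation^T = 1%:M.
Proof.
rewrite rotationT -scalemxAl -scalemxAr scalerA sqrt2V mulmxBr mulmx1 mulmxDl.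
by rewrite mul1mx block_complex_structure_sqr opprD opprK addrA addrK half_double.
Qed.

Let det_rotation : \det rotation = 1.
Proof.
(* Both factors are block triangular, so the determinant is 2^n, which the scalar factor of
   [rotation] cancels. *)
have rE : 1%:M + J = block_mx 1%:M 0 (- 1%:M) 1%:M *m block_mx 1%:M 1%:M 0 2%:M.
  rewrite mulmx_block !mulmx0 !mul0mx !mul1mx !mulmx1 !addr0.
  rewrite (scalar_mx_block n n 1) add_block_mx.
  congr block_mx; rewrite ?(addr0 1%:M) ?(add0r 1%:M) ?(add0r (- 1%:M)) //.
  by apply/matrixP => i j; rewrite !mxE; case: (i == j); rewrite /=; lra.
rewrite /rotation rE detZ det_mulmx det_lblock det_ublock !det1 det_scalar !mul1r.
by rewrite exprD -exprMn sqrt2V -exprMn mulVf // expr1n.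
Qed.

(** In the expansion of (1 + J) Z (1 - J) / 2 with [Z] anticommuting with [J], the terms Z and - J Z
    J cancel and the other two add up to J Z. So conjugation by [rotation] is left multiplication by
    [J]. *)
Let BJ X Y : J *m X = - (X *m J) -> J *m Y = - (Y *m J) ->
  B (J *m X) (J *m Y) = B X Y.
Proof.
have rotE Z : J *m Z = - (Z *m J) -> rotation *m Z *m rotation^T = J *m Z.
  move=> JZ; rewrite rotationT -scalemxAl -scalemxAl -scalemxAr scalerA sqrt2V.
  rewrite mulmxBr mulmxDl mul1mx mulmx1 mulmxDl -[Z *m J]opprK -JZ -(mulmxA J).
  have -> : J *m (Z *m J) = Z.
    by rewrite -[Z *m J]opprK -JZ mulmxN mulmxA block_complex_structure_sqr mulNmx opprK mul1mx.
  by rewrite opprD opprK addrC addrA subrK half_double.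
by move=> JX JY; rewrite -[RHS](invariant rotation_orthogonal det_rotation) !rotE.
Qed.

Let detJ : \det J = 1.
Proof.
have -> : J = rotation *m rotation.
  rewrite -scalemxAl -scalemxAr scalerA sqrt2V mulmxDl mul1mx mulmxDr mulmx1.
  by rewrite block_complex_structure_sqr addrC addrA subrK half_double.
by rewrite det_mulmx det_rotation mulr1.
Qed.

(** On R^n + R^n = C^n this is complex conjugation followed by [P]. *)
Let Phi (P : 'M[R]_n) : 'M[R]_(n + n) := block_mx P 0 0 (- P).

Let Phi_linear a P Q : Phi (a *: P + Q) = a *: Phi P + Phi Q.
Proof.
rewrite scale_block_mx add_block_mx !scaler0 !addr0; congr block_mx.
by rewrite opprD scalerN.
Qed.

Let JPhi P : J *m Phi P = block_mx 0 (- P) (- P) 0.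
Proof.
by rewrite mulmx_block !mulmx0 !mul0mx !mul1mx mulNmx mul1mx !addr0 !add0r.
Qed.

Let JPhi_anti P : J *m Phi P = - (Phi P *m J).
Proof.
rewrite JPhi mulmx_block !mulmx0 !mul0mx !mulmx1 !addr0 !add0r.
by rewrite opp_block_mx !oppr0 mulmxN mulmx1 opprK.
Qed.

(** The determinant is (det O)^2 = 1 even when det O = -1. Hence invariance under rotations of
    R^(2n) gives invariance under all of O(n), as [orthogonal_invariant_form] requires. *)
Let double O : O *m O^T = 1%:M ->
  let D : 'M[R]_(n + n) := block_mx O 0 0 O in
  [/\ D *m D^T = 1%:M, \det D = 1,
      (forall P, D *m Phi P *m D^T = Phi (O *m P *m O^T)) &
      (forall P, D *m (J *m Phi P) *m D^T = J *m Phi (O *m P *m O^T))].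
Proof.
move=> OO D.
have DT : D^T = block_mx O^T 0 0 O^T by rewrite tr_block_mx !trmx0.
have mulD A1 A2 A3 A4 : D *m block_mx A1 A2 A3 A4 *m D^T =
   block_mx (O *m A1 *m O^T) (O *m A2 *m O^T) (O *m A3 *m O^T) (O *m A4 *m O^T).
  by rewrite DT !mulmx_block !mulmx0 !mul0mx !addr0 !add0r.
split.
- by rewrite DT mulmx_block !mulmx0 !mul0mx !addr0 !add0r OO -scalar_mx_block.
- have := congr1 determinant OO.
  by rewrite det_mulmx det_tr det1 det_ublock.
- by move=> P; rewrite mulD !mulmx0 !mul0mx mulmxN mulNmx.
- by move=> P; rewrite !JPhi mulD !mulmx0 !mul0mx mulmxN mulNmx.
Qed.

Let anti_skew_block X : X^T = - X -> J *m X = - (X *m J) ->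
  exists P Q, [/\ P^T = - P, Q^T = - Q & X = Phi P - J *m Phi Q].
Proof.
move=> Xs JX; exists (ulsubmx X), (ursubmx X).
move: JX Xs; rewrite -{1 2 3 4}[X]submxK.
set P := ulsubmx X; set Q := ursubmx X; set S := dlsubmx X; set T := drsubmx X.
rewrite !mulmx_block !mulmx0 !mul0mx !mul1mx !mulmx1 !addr0 !add0r.
rewrite !mulNmx !mulmxN !mul1mx !mulmx1 !opp_block_mx !opprK.
move=> /eq_block_mx[SQ TP _ _]; rewrite tr_block_mx.
move=> /eq_block_mx[PT _ QT _]; split=> //; first by rewrite QT SQ.
rewrite -[LHS]submxK -/P -/Q -/S -/T SQ TP add_block_mx !oppr0.
by congr block_mx; rewrite ?(addr0 P) ?(add0r Q) ?(addr0 (- P)).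
Qed.

(* With P, Q skew, the J-antilinear skew matrices are [Phi P - J *m Phi Q], on which
   the matrices [block_mx O 0 0 O] act by conjugation of P and Q, and the rotation by
   pi/4 acts as multiplication by J. *)
Lemma unitary_invariant_form : exists k, forall X Y,
  X^T = - X -> J *m X = - (X *m J) -> Y^T = - Y -> B X Y = k * \tr (X^T *m Y).
Proof.
have [k1 b1] : exists k, forall P Q : 'M[R]_n, P^T = - P -> Q^T = - Q ->
    B (Phi P) (Phi Q) = k * \tr (P^T *m Q).
  apply: (orthogonal_invariant_form (b := fun P Q => B (Phi P) (Phi Q))) => /=.
  - by move=> *; rewrite Phi_linear linear_l.
  - by move=> *; rewrite Phi_linear linear_r.
  - by move=> O /double[D1 D2 D3 _] P Q; rewrite -!D3 invariant.
have [k2 b2] : exists k, forall P Q : 'M[R]_n, P^T = - P -> Q^T = - Q ->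
    B (Phi P) (J *m Phi Q) = k * \tr (P^T *m Q).
  apply: (orthogonal_invariant_form (b := fun P Q => B (Phi P) (J *m Phi Q))) => /=.
  - by move=> *; rewrite Phi_linear linear_l.
  - by move=> *; rewrite Phi_linear mulmxDr -scalemxAr linear_r.
  - by move=> O /double[D1 D2 D3 D4] P Q; rewrite -D4 -D3 invariant.
(* Multiplying both arguments by [J] exchanges [P] and [Q] at the cost of a sign, while by [b2] the
   value is symmetric in [P] and [Q]. *)
have b0 (P Q : 'M[R]_n) : P^T = - P -> Q^T = - Q -> B (Phi P) (J *m Phi Q) = 0.
  move=> Ps Qs; have JJ : J *m (J *m Phi Q) = - Phi Q.
    by rewrite mulmxA block_complex_structure_sqr mulNmx mul1mx.
  have : B (J *m Phi P) (J *m (J *m Phi Q)) = B (Phi P) (J *m Phi Q).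
    by rewrite BJ // JJ JPhi_anti mulNmx opprK -mulmxA block_complex_structure_sqr mulmxN mulmx1.
  rewrite JJ BNr symmetric !b2 // Ps Qs !mulNmx !linearN /= (mxtrace_mulC Q P); lra.
(* In the trace form each of [P] and [Q] occurs in two blocks, hence the constant [k1 / 2]. *)
have anti X Y : X^T = - X -> J *m X = - (X *m J) -> Y^T = - Y -> J *m Y = - (Y *m J) ->
    B X Y = k1 / 2 * \tr (X^T *m Y).
  move=> Xs JX Ys JY.
  have [P [Q [Ps Qs ->]]] := anti_skew_block Xs JX.
  have [P' [Q' [Ps' Qs' ->]]] := anti_skew_block Ys JY.
  rewrite BBl !BBr BJ // !b0 // (symmetric (J *m Phi Q)) b0 // !b1 //.
  have blockE U V : Phi U - J *m Phi V = block_mx U V V (- U).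
    rewrite JPhi opp_block_mx add_block_mx !opprK !oppr0.
    by congr block_mx; rewrite ?(addr0 U) ?(add0r V) ?(addr0 (- U)).
  have NT (U : 'M[R]_n) : (- U)^T = - U^T by apply/matrixP => i j; rewrite !mxE.
  rewrite !blockE tr_block_mx mulmx_block mxtrace_block NT.
  rewrite mulNmx mulmxN opprK !mxtraceD; lra.
exists (k1 / 2) => X Y Xs JX Ys.
have JXJ : J *m X *m J^T = - X.
  by rewrite JX block_complex_structureT mulNmx mulmxN opprK -mulmxA
     block_complex_structure_sqr mulmxN mulmx1.
have JJT : J *m J^T = 1%:M.
  by rewrite block_complex_structureT mulmxN block_complex_structure_sqr opprK.
have JTJ : J^T *m J = 1%:M.
  by rewrite block_complex_structureT mulNmx block_complex_structure_sqr opprK.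
(* Conjugation by [J] negates [X], so replacing [Y] by [Y'] changes the sign of both forms. It
   suffices to compare them on [Y - Y'], which anticommutes with [J]. *)
pose Y' := J *m Y *m J^T.
have Ys' : Y'^T = - Y' by rewrite !trmx_mul trmxK Ys mulNmx mulmxN mulmxA.
have BY : B X Y' = - B X Y by rewrite -[in RHS](invariant JJT detJ) JXJ BNl opprK.
have trY : \tr (X^T *m Y') = - \tr (X^T *m Y).
  have JTXJ : J^T *m X *m J = - X.
    by rewrite block_complex_structureT mulNmx JX opprK -mulmxA
       block_complex_structure_sqr mulmxN mulmx1.
  rewrite /Y' mulmxA mxtrace_mulC !mulmxA Xs mulmxN mulNmx JTXJ opprK.
  by rewrite mulNmx linearN opprK.
have trB : \tr (X^T *m (Y - Y')) = \tr (X^T *m Y) - - \tr (X^T *m Y).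
  by rewrite mulmxBr linearB /= trY.
suff: B X Y - - B X Y = k1 / 2 * (\tr (X^T *m Y) - - \tr (X^T *m Y)) by lra.
rewrite -trB -BY -BBr; apply: anti => //.
  by rewrite linearB /= Ys' Ys opprB opprK addrC.
rewrite mulmxBr mulmxBl opprB; congr (_ - _).
  by rewrite -mulmxA JTJ mulmx1.
rewrite /Y' !mulmxA block_complex_structure_sqr block_complex_structureT.
by rewrite mulmxN !mulNmx mul1mx opprK.
Qed.

End UnitaryInvariantForm.

(** * The dot product *)

Section DotProduct.
Variables (R : realType) (N : nat).
Implicit Types (u v w : 'cV[R]_N) (A X : 'M[R]_N).

Definition dot u v : R := (u^T *m v) 0 0.

Lemma trmx_mul_dot u v : u^T *m v = (dot u v)%:M.
Proof. exact: mx11_scalar. Qed.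

Lemma dotE u v : dot u v = \sum_i u i 0 * v i 0.
Proof. by rewrite /dot mxE; apply: eq_bigr => i _; rewrite mxE. Qed.

Lemma dotC u v : dot u v = dot v u.
Proof. by rewrite !dotE; apply: eq_bigr => i _; rewrite mulrC. Qed.

Lemma dotDr u v w : dot u (v + w) = dot u v + dot u w.
Proof. by rewrite /dot mulmxDr mxE. Qed.

Lemma dotZr a u v : dot u (a *: v) = a * dot u v.
Proof. by rewrite /dot -scalemxAr mxE. Qed.

Lemma dotNr u v : dot u (- v) = - dot u v.
Proof. by rewrite -scaleN1r dotZr mulN1r. Qed.

Lemma dotBr u v w : dot u (v - w) = dot u v - dot u w.
Proof. by rewrite dotDr dotNr. Qed.

Lemma dotDl u v w : dot (v + w) u = dot v u + dot w u.
Proof. by rewrite dotC dotDr !(dotC u). Qed.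

Lemma dotZl a u v : dot (a *: v) u = a * dot v u.
Proof. by rewrite dotC dotZr dotC. Qed.

Lemma dotNl u v : dot (- v) u = - dot v u.
Proof. by rewrite dotC dotNr dotC. Qed.

Lemma dotBl u v w : dot (v - w) u = dot v u - dot w u.
Proof. by rewrite dotDl dotNl. Qed.

Lemma dot_mulmxl A u v : dot (A *m u) v = dot u (A^T *m v).
Proof. by rewrite /dot trmx_mul mulmxA. Qed.

Lemma dot_orthogonal A u v : A^T *m A = 1%:M -> dot (A *m u) (A *m v) = dot u v.
Proof. by move=> AA; rewrite dot_mulmxl mulmxA AA mul1mx. Qed.

Lemma dot_skew X u v : X^T = - X -> dot (X *m u) v = - dot u (X *m v).
Proof. by move=> Xs; rewrite dot_mulmxl Xs mulNmx dotNr. Qed.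

Lemma dot_skew_diag X u : X^T = - X -> dot u (X *m u) = 0.
Proof. by move=> Xs; have := dot_skew u u Xs; rewrite dotC; lra. Qed.

Lemma dot_ge0 u : 0 <= dot u u.
Proof. by rewrite dotE sumr_ge0 // => i _; rewrite -expr2 sqr_ge0. Qed.

Lemma dot_eq0 u : (dot u u == 0) = (u == 0).
Proof.
apply/idP/eqP => [|->]; last by rewrite /dot mulmx0 mxE.
rewrite dotE psumr_eq0 => [/allP u0|i _]; last by rewrite -expr2 sqr_ge0.
apply/colP => i; have := u0 i (mem_index_enum i).
by rewrite mxE /= mulf_eq0 orbb => /eqP.
Qed.

Lemma dot_gt0 u : (0 < dot u u) = (u != 0).
Proof. by rewrite lt0r dot_eq0 dot_ge0 andbT. Qed.

Lemma dot_delta i u : dot (delta_mx i 0) u = u i 0.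
Proof.
rewrite dotE (bigD1 i) //= mxE !eqxx mul1r big1 ?addr0 // => j ji.
by rewrite mxE (negbTE ji) mul0r.
Qed.

End DotProduct.

(** * Differential calculus *)

Lemma near_eq_is_diff (R : numFieldType) (V W : normedModType R) (f g : V -> W) x :
  (\forall y \near x, f y = g y) -> differentiable f x ->
  is_diff x g ('d f x).
Proof.
move=> fg df.
have g_expand : g \o shift x = cst (g x) + 'd f x +o_ 0 id.
  apply/eqaddoE; rewrite -(nbhs_singleton fg) -/(f x).
  have := diff_locally df => /eqaddoP H; apply/eqaddoP => e e0.
  have fg' : \forall h \near (0 : V), f (h + x) = g (h + x).
    rewrite (near_shift x) sub0r; near=> y; rewrite /= subrK.
    by near: y.
  apply: filterS2 fg' (H e e0) => h fgh.
  by rewrite !fctE /= fgh.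
have dg : 'd g x = 'd f x :> (V -> W).
  by apply: diff_unique => //; exact: diff_continuous.
apply: DiffDef => //; apply/diff_locallyP; rewrite dg; split => //.
exact: diff_continuous.
Unshelve. all: by end_near. Qed.

Section Ck.
Variables (R : realType) (V : normedModType R).
Implicit Types (U : set V) (k : nat).


Lemma Ck_continuous (W : normedModType R) k U (f : V -> W) :
  Ck k U f -> forall x, U x -> {for x, continuous f}.
Proof.
case: k => [|k] // [df _] x Ux.
exact/differentiable_continuous/df.
Qed.

Lemma CkW (W : normedModType R) k U (f : V -> W) : Ck k.+1 U f -> Ck k U f.
Proof.
elim: k f => [f /Ck_continuous//|k IH f [df dfk]].
by split=> // v; exact/IH/dfk.
Qed.

Lemma Ck_sub (W : normedModType R) k U U' (f : V -> W) :
  U' `<=` U -> Ck k U f -> Ck k U' f.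
Proof.
move=> sub; elim: k f => [f cf x /sub/cf//|k IH f [df dfk]].
by split=> [x /sub/df//|v]; exact/IH/dfk.
Qed.

Lemma Ck_eq (W : normedModType R) k U (f g : V -> W) : open U ->
  (forall x, U x -> f x = g x) -> Ck k U f -> Ck k U g.
Proof.
move=> oU; elim: k f g => [f g fg cf x Ux|k IH f g fg [df dfk]].
  have fgx : \forall y \near x, f y = g y.
    by apply: filterS (open_nbhs_nbhs (conj oU Ux)) => y /fg.
  rewrite /prop_for /continuous_at -(fg _ Ux).
  by apply: cvg_trans (cf x Ux); apply: near_eq_cvg.
have dfg x : U x -> is_diff x g ('d f x).
  move=> Ux; apply: near_eq_is_diff (df x Ux).
  by apply: filterS (open_nbhs_nbhs (conj oU Ux)) => y /fg.
split=> [x /dfg[]//|v]; apply: IH (dfk v) => x /dfg dfgx.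
by rewrite (diff_val (is_diff_def := dfgx)).
Qed.

Lemma Ck_cst (W : normedModType R) k U (a : W) : Ck k U (fun=> a).
Proof.
elim: k a => [a x _|k IH a]; first exact: cvg_cst.
split=> [x _|v]; first exact: differentiable_cst.
by rewrite (_ : (fun x => _) = fun=> 0) //; apply/funext => x; rewrite diff_cst.
Qed.

Lemma Ck_linear (W : normedModType R) k U (f : {linear V -> W}) :
  continuous f -> Ck k U f.
Proof.
move=> cf; case: k => [x _|k]; first exact: cf.
split=> [x _|v]; first exact: linear_differentiable.
rewrite (_ : (fun x => _) = fun=> f v); first exact: Ck_cst.
by apply/funext => x; rewrite diff_lin.
Qed.

Lemma Ck_comp_linear (W W' : normedModType R) k U (f : V -> W) (L : {linear W -> W'}) :
  open U -> continuous L -> Ck k U f -> Ck k U (L \o f).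
Proof.
move=> oU cL; elim: k f => [f cf x Ux|k IH f [df dfk]].
  by apply: continuous_comp; [exact: cf|exact: cL].
split=> [x Ux|v]; first by apply: differentiable_comp; [exact: df|exact: linear_differentiable].
apply: Ck_eq (IH _ (dfk v)) => // x Ux.
by rewrite diff_comp /= ?diff_lin//; [exact: df|exact: linear_differentiable].
Qed.

Lemma CkD (W : normedModType R) k U (f g : V -> W) : open U ->
  Ck k U f -> Ck k U g -> Ck k U (fun x => f x + g x).
Proof.
move=> oU; elim: k f g => [f g cf cg x Ux|k IH f g [df dfk] [dg dgk]].
  by apply: cvgD; [exact: cf|exact: cg].
split=> [x Ux|v]; first by apply: differentiableD; [exact: df|exact: dg].
apply: Ck_eq (IH _ _ (dfk v) (dgk v)) => // x Ux.
by rewrite -[RHS]/('d (f + g) x v) diffD//; [exact: df|exact: dg].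
Qed.

Lemma Ck_sum (W : normedModType R) k U (I : Type) (r : seq I) (F : I -> V -> W) : open U ->
  (forall i, Ck k U (F i)) -> Ck k U (fun x => \sum_(i <- r) F i x).
Proof.
move=> oU CF; elim: r => [|i r IH].
  by rewrite (_ : (fun x => _) = fun=> 0); [exact: Ck_cst|apply/funext => x; rewrite big_nil].
rewrite (_ : (fun x => _) = fun x => F i x + \sum_(i <- r) F i x); first exact: CkD.
by apply/funext => x; rewrite big_cons.
Qed.

Lemma CkM k U (f g : V -> R) : open U ->
  Ck k U f -> Ck k U g -> Ck k U (fun x => f x * g x).
Proof.
move=> oU; elim: k f g => [f g cf cg x Ux|k IH f g Cf Cg].
  by apply: cvgM; [exact: cf|exact: cg].
have [df dfk] := Cf; have [dg dgk] := Cg.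
split=> [x Ux|v]; first by apply: differentiableM; [exact: df|exact: dg].
have C1 := IH _ _ (CkW Cf) (dgk v); have C2 := IH _ _ (CkW Cg) (dfk v).
apply: Ck_eq (CkD oU C1 C2) => // x Ux.
by rewrite -[RHS]/('d (f * g) x v) diffM//; [exact: df|exact: dg].
Qed.

End Ck.

Lemma linear_mx_continuous (R : realType) m n (W : normedModType R)
  (f : {linear 'M[R]_(m, n) -> W}) : continuous f.
Proof.
have -> : (f : _ -> _) = \sum_i \sum_j (fun M : 'M[R]_(m, n) => M i j *: f (delta_mx i j)).
  apply/funext => M; rewrite {1}[M]matrix_sum_delta linear_sum fct_sumE.
  apply: eq_bigr => i _; rewrite linear_sum fct_sumE.
  by apply: eq_bigr => j _; rewrite linearZ.
move=> M; apply: differentiable_continuous.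
apply: differentiable_sum => i; apply: differentiable_sum => j.
exact/differentiableZl/differentiable_coord.
Qed.

Lemma Ck_linear_mx (R : realType) m n (W : normedModType R) k U
  (f : {linear 'M[R]_(m, n) -> W}) : Ck k U f.
Proof. exact/Ck_linear/linear_mx_continuous. Qed.

Lemma Ck_mxE (R : realType) (V : normedModType R) m n k (U : set V)
  (f : V -> 'M[R]_(m, n)) : open U ->
  (Ck k U f <-> forall i j, Ck k U (fun x => f x i j)).
Proof.
move=> oU; split=> [Cf i j|Cf].
  pose c (M : 'M[R]_(m, n)) := M i j.
  have c_lin : linear c by move=> a A B; rewrite /c !mxE.
  pose cM := GRing.isLinear.Build _ _ _ _ _ c_lin.
  pose cL : {linear _ -> _} := HB.pack c cM.
  exact: (@Ck_comp_linear _ _ _ _ _ _ _ cL) oU (@linear_mx_continuous _ _ _ _ cL) Cf.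
pose s i j := *:%R ^~ (delta_mx i j) : R -> 'M[R]_(m, n).
rewrite (_ : f = fun x => \sum_i \sum_j s i j (f x i j)); last first.
  by apply/funext => x; exact: matrix_sum_delta.
apply: Ck_sum => // i; apply: Ck_sum => // j.
have s_lin : linear (s i j) by move=> a A B; rewrite /s scalerDl scalerA.
pose sM := GRing.isLinear.Build _ _ _ _ _ s_lin.
pose sL : {linear _ -> _} := HB.pack (s i j) sM.
apply: (@Ck_comp_linear _ _ _ _ _ _ (fun x => f x i j) sL) => //.
exact: scalel_continuous.
Qed.

Lemma Ck_mulmx (R : realType) (V : normedModType R) m n p k (U : set V)
  (f : V -> 'M[R]_(m, n)) (g : V -> 'M[R]_(n, p)) : open U ->
  Ck k U f -> Ck k U g -> Ck k U (fun x => f x *m g x).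
Proof.
move=> oU /(Ck_mxE _ _ oU) Cf /(Ck_mxE _ _ oU) Cg; apply/(Ck_mxE _ _ oU) => i j.
rewrite (_ : (fun x => _) = fun x => \sum_l f x i l * g x l j); last first.
  by apply/funext => x; rewrite mxE.
by apply: Ck_sum => // l; exact: CkM.
Qed.

(** By the quotient rule the derivative is again a quotient of polynomials, with denominator [r * r]
    free of zeros, so the class is stable under differentiation. *)
Lemma Ck_poly_frac (R : realType) k (U : set R) (p r : {poly R}) :
  (forall t, r.[t] != 0) -> Ck k U (fun t => p.[t] / r.[t]).
Proof.
have diff_frac (p' r' : {poly R}) t : (forall t, r'.[t] != 0) ->
    is_derive t (1 : R) (fun t => p'.[t] / r'.[t])
      ((p'^`() * r' - p' * r'^`()).[t] / (r' * r').[t]).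
  move=> r'0; have dp := is_derive_poly p' t; have dr := is_derive_poly r' t.
  have dV : is_derive t (1 : R) (fun t => r'.[t]^-1) (- (r'.[t] ^- 2) *: r'^`().[t]).
    by have [? dr'] := dr; apply: DeriveDef; [exact: derivableV|rewrite deriveV ?dr'].
  have [d1 d2] := is_deriveM dp dV.
  apply: DeriveDef; [exact: d1|rewrite [LHS]d2].
  rewrite !hornerE /= /GRing.scale /=; field; exact: r'0.
elim: k p r => [p r r0 t _|k IH p r r0].
  have [/derivable1_diffP dt _] := diff_frac p r t r0.
  exact: differentiable_continuous.
split=> [t _|v].
  by have [/derivable1_diffP] := diff_frac p r t r0.
rewrite (_ : (fun x => _) = fun t =>
    (v%:P * (p^`() * r - p * r^`())).[t] / (r * r).[t]).
  by apply: IH => t; rewrite hornerM mulf_neq0.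
apply/funext => t; have [/derivable1_diffP dt dE] := diff_frac p r t r0.
by rewrite diff1E // derive1E dE [in RHS]hornerM hornerC -mulrA.
Qed.

Lemma diff_quadratic (R : realType) (V W : normedModType R) (f : V -> W) a v b c :
  differentiable f a ->
  (forall h : R, f (h *: v + a) = f a + h *: b + h ^+ 2 *: c) -> 'd f a v = b.
Proof.
move=> df fE; rewrite -deriveE //; apply: cvg_lim => //.
have : (fun h : R => b + h *: c) @ 0^' --> b + (0 : R) *: c.
  apply: cvg_within_filter.
  by apply: cvgD; [exact: cvg_cst|apply: cvgZr_tmp; exact: cvg_id].
rewrite scale0r addr0; apply: cvg_trans; apply: near_eq_cvg; near=> h.
have h0 : h != 0 by near: h; exact: nbhs_dnbhs_neq.
rewrite /= fE addrAC [f a + _]addrC addrK scalerDr !scalerA mulVf // scale1r.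
by rewrite expr2 mulrA mulVf ?mul1r.
Unshelve. all: by end_near. Qed.

Lemma smooth_near_is_diff (R : realType) (V W : normedModType R) x (f : V -> W) :
  smooth_near x f -> differentiable f x.
Proof. by move=> [U [_ Ux /(_ 1%N)[/(_ _ Ux)]]]. Qed.

Lemma diff_curve (R : realType) (V W : normedModType R) (c : R -> V) (f : V -> W) :
  differentiable c 0 -> differentiable f (c 0) ->
  'd (f \o c) (0 : R) (1 : R) = 'd f (c 0) ('d c (0 : R) (1 : R)).
Proof. by move=> dc df; rewrite diff_comp. Qed.

(** The selected extension and [f] agree on [M] near [p], hence along a curve of [M] with velocity
    [u]. By the chain rule both differentials send [u] to the velocity of the same image curve. *)
Lemma tangent_mapE (R : realType) (V W : normedModType R) (M : set V) (f : V -> W) p u :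
  smooth_near p f -> tangent M p u -> tangent_map M f p u = 'd f p u.
Proof.
move=> sf [c [/smooth_near_is_diff dc Mc c0 <-]].
have [|] := @xgetPex _ (cst 0) (local_extension M f p).
  by exists f; split => //; exact: nearW.
rewrite /tangent_map; move: (xget _ _) => F /smooth_near_is_diff dF Ff.
have df := smooth_near_is_diff sf.
subst p; rewrite -(diff_curve dc dF) -(diff_curve dc df).
have dFc : differentiable (F \o c) 0 by exact: differentiable_comp.
have cc : c t @[t --> (0 : R)] --> c 0 by exact: differentiable_continuous.
have FMc := cc _ Ff.
have Fcfc : \forall t \near (0 : R), (F \o c) t = (f \o c) t.
  by apply: filterS2 Mc FMc => t Mt; exact.
by have [_ dE] := near_eq_is_diff Fcfc dFc; exact: esym (congr1 (@^~ 1) dE).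
Qed.

Lemma diff_constant_on (R : realType) (V W : normedModType R) (M : set V) (F : V -> W) a p u :
  differentiable F p -> (forall x, M x -> F x = a) -> tangent M p u -> 'd F p u = 0.
Proof.
move=> dF Fa [c [/smooth_near_is_diff dc Mc c0 <-]]; subst p.
have Fca : \forall t \near (0 : R), cst a t = (F \o c) t.
  by apply: filterS Mc => t /Fa.
rewrite -(diff_curve dc dF).
have [_ ->] := near_eq_is_diff Fca (differentiable_cst a (0 : R)).
by rewrite diff_cst.
Qed.

(** * Tangent spaces of SO(N) and of the sphere *)

Lemma smooth_near_global (R : realType) (V W : normedModType R) x (f : V -> W) :
  (forall k, Ck k setT f) -> smooth_near x f.
Proof. by exists setT; split => //; exact: openT. Qed.

(** With [J] the identity this map gives the equation of the orthogonal group; with [J] a complex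
    structure it is the map K of the submersion. *)
Lemma Ck_congruence (R : realType) N (J : 'M[R]_N) k :
  Ck k setT (fun P : 'M[R]_N => P^T *m J *m P).
Proof.
have CT : Ck k setT (fun P : 'M[R]_N => P^T) by exact: (Ck_linear_mx k setT trmx).
have Cid : Ck k setT (fun P : 'M[R]_N => P) by exact: (Ck_linear_mx k setT idfun).
apply: Ck_mulmx Cid; first exact: openT.
by apply: Ck_mulmx CT _; [exact: openT|exact: Ck_cst].
Qed.

Lemma diff_congruence (R : realType) N (J A X : 'M[R]_N) :
  'd (fun P : 'M[R]_N => P^T *m J *m P) A X = X^T *m J *m A + A^T *m J *m X.
Proof.
apply: (@diff_quadratic _ _ _ _ _ _ _ (X^T *m J *m X)).
  by have [+ _] := Ck_congruence J 1; exact.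
move=> h; have -> : (h *: X + A)^T = h *: X^T + A^T by apply/matrixP => i j; rewrite !mxE.
rewrite !mulmxDl !mulmxDr -!scalemxAl -!scalemxAr !scalerA -expr2 scalerDr.
by rewrite [LHS](AC (2*2) (4*(2*3)*1)).
Qed.

Lemma SO_tangent_skew (R : realType) N (A X : 'M[R]_N) :
  tangent (SO R N) A (A *m X) -> SO R N A -> X^T = - X.
Proof.
move=> tX [AA _]; have ATA : A^T *m A = 1%:M by exact: mulmx1C.
have dC : differentiable (fun P : 'M[R]_N => P^T *m 1%:M *m P) A.
  by have [+ _] := Ck_congruence (1%:M : 'M[R]_N) 1; exact.
have : 'd (fun P : 'M[R]_N => P^T *m 1%:M *m P) A (A *m X) = 0.
  apply: (diff_constant_on (a := 1%:M) dC) tX => B [BB _].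
  by rewrite mulmx1; exact: mulmx1C.
rewrite diff_congruence !mulmx1 trmx_mul -(mulmxA X^T) ATA mulmx1.
by rewrite mulmxA ATA mul1mx => /eqP; rewrite addr_eq0 => /eqP.
Qed.

Section Cayley.
Variables (R : realType) (N : nat) (X : 'M[R]_N).
Hypothesis skew : X^T = - X.

(** A kernel vector would give, after transposition, a nonzero v with X v = - v, whereas a skew [X]
    sends v to a vector orthogonal to v. *)
Lemma det_one_sub_skew : \det (1%:M - X) != 0.
Proof.
apply/det0P => -[v v0 /(congr1 trmx)].
rewrite trmx_mul linearB /= trmx1 skew opprK trmx0 mulmxDl mul1mx => vX.
have := dot_skew_diag v^T skew.
have -> : X *m v^T = - v^T by apply/eqP; rewrite -addr_eq0 addrC vX.
by rewrite dotNr => /eqP; rewrite oppr_eq0 dot_eq0 trmx_eq0 (negbTE v0).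
Qed.

(** The Cayley transform, in the role of the exponential: along [t *: X] its entries are rational
    functions of t. *)
Definition cayley := invmx (1%:M - X) *m (1%:M + X).

Let unit_sub : 1%:M - X \in unitmx.
Proof. by rewrite unitmxE unitfE det_one_sub_skew. Qed.

Let tr_sub : (1%:M - X)^T = 1%:M + X.
Proof. by rewrite linearB /= trmx1 skew opprK. Qed.

Lemma cayley_SO : SO R N cayley.
Proof.
have commute : (1%:M + X) *m (1%:M - X) = (1%:M - X) *m (1%:M + X).
  by rewrite mulmxDl mulmxBl !mul1mx mulmxBr mulmxDr !mulmx1 opprD !addrA subrK addrK.
have inv_mul : invmx (1%:M - X) *m (1%:M + X) = (1%:M + X) *m invmx (1%:M - X).
  by apply: (canRL (mulmxK unit_sub)); rewrite -mulmxA commute mulKmx.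
split.
  rewrite /cayley {1}inv_mul trmx_mul -tr_sub trmxK trmx_inv tr_sub.
  rewrite -mulmxA (mulmxA (invmx (1%:M - X))) mulVmx // mul1mx mulmxV //.
  by rewrite -tr_sub unitmx_tr.
rewrite det_mulmx det_inv -tr_sub det_tr mulVf //; exact: det_one_sub_skew.
Qed.

(** The increment from the identity appears as a multiple of [X], so that the derivative of the
    transform of [t *: X] at 0 is found without differentiating an inverse. *)
Lemma cayley_eq : cayley = 1%:M + X *m (cayley + 1%:M).
Proof.
have : (1%:M - X) *m cayley = 1%:M + X by rewrite mulKVmx.
rewrite mulmxBl mul1mx => /eqP; rewrite subr_eq => /eqP {1}->.
by rewrite mulmxDr mulmx1 -addrA [X + _]addrC.
Qed.

End Cayley.

(** Cramer's rule over the polynomial ring: the inverse is the adjugate divided by a determinant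
    without real zeros. *)
Lemma Ck_cayley (R : realType) N (X : 'M[R]_N) k : X^T = - X ->
  Ck k setT (fun t : R => cayley (t *: X)).
Proof.
move=> skew; apply/(Ck_mxE _ _ openT) => i j.
pose XP : 'M[{poly R}]_N := 'X *: map_mx polyC X.
pose S : 'M[{poly R}]_N := 1%:M - XP.
have evX t : map_mx (horner_eval t) XP = t *: X.
  by apply/matrixP => a b; rewrite !mxE /horner_eval hornerM hornerX hornerC.
have evS t : map_mx (horner_eval t) S = 1%:M - t *: X.
  by rewrite map_mxB evX map_mx1.
have evP t : map_mx (horner_eval t) (1%:M + XP) = 1%:M + t *: X.
  by rewrite map_mxD evX map_mx1.
have skewZ (t : R) : (t *: X)^T = - (t *: X) by rewrite linearZ /= skew scalerN.
have detS t : (\det S).[t] = \det (1%:M - t *: X) by rewrite -evS det_map_mx.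
rewrite (_ : (fun t => _) = fun t => ((\adj S *m (1%:M + XP)) i j).[t] / (\det S).[t]).
  by apply: Ck_poly_frac => t; rewrite detS; exact: det_one_sub_skew.
apply/funext => t; rewrite /cayley /invmx unitmxE unitfE det_one_sub_skew //.
rewrite -scalemxAl mxE -evS -evP det_map_mx -map_mx_adj -map_mxM mxE.
by rewrite mulrC.
Qed.

Lemma tangent_SO (R : realType) N (A X : 'M[R]_N) : SO R N A -> X^T = - X ->
  tangent (SO R N) A (A *m X).
Proof.
move=> [AA dA] skew.
(* The Cayley transform of [t *: X] has derivative 2 X at 0; halving [X] compensates for this. *)
pose X2 := (2^-1 : R) *: X.
have skew2 (t : R) : (t *: X2)^T = - (t *: X2) by rewrite !linearZ /= skew !scalerN.
pose c t := A *m cayley (t *: X2).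
have Cc k : Ck k setT c.
  apply: Ck_mulmx; [exact: openT|exact: Ck_cst|apply: Ck_cayley].
  by rewrite -[X2]scale1r.
have c0 : c 0 = A by rewrite /c scale0r /cayley subr0 addr0 invmx1 !mulmx1.
exists c; split => //; first exact: smooth_near_global.
  near=> t; rewrite /c; have [CC dC] : SO R N (cayley (t *: X2)).
    exact/cayley_SO/skew2.
  split; last by rewrite det_mulmx dA dC mulr1.
  by rewrite trmx_mul -mulmxA (mulmxA (cayley _)) CC mul1mx.
have dc : differentiable c 0 by have [+ _] := Cc 1%N; exact.
rewrite -deriveE //; apply: cvg_lim => //.
have X2X : X2 + X2 = X by rewrite -scalerDl -div1r -splitr scale1r.
have E t : c t = A + t *: (A *m X2 *m (cayley (t *: X2) + 1%:M)).
  by rewrite /c {1}(cayley_eq (skew2 t)) mulmxDr mulmx1 -scalemxAl -scalemxAr mulmxA.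
(* Since [A^T *m c t] is the Cayley factor, this is the difference quotient of [c] for nonzero t,
   written as a function continuous at 0. *)
have : (A *m X2 *m (A^T *m c t + 1%:M)) @[t --> (0 : R)^'] --> A *m X2 *m (A^T *m c 0 + 1%:M).
  apply: cvg_within_filter.
  have C1 : Ck 0 setT (fun t => A^T *m c t).
    by apply: Ck_mulmx; [exact: openT|exact: Ck_cst|exact: Cc].
  have C2 : Ck 0 setT (fun t => A^T *m c t + 1%:M).
    by apply: CkD; [exact: openT|exact: C1|exact: Ck_cst].
  have C3 : Ck 0 setT (fun t => A *m X2 *m (A^T *m c t + 1%:M)).
    by apply: Ck_mulmx; [exact: openT|exact: Ck_cst|exact: C2].
  exact: (C3 0 I).
rewrite c0 (mulmx1C AA) mulmxDr mulmx1 -mulmxDr X2X.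
apply: cvg_trans; apply: near_eq_cvg; near=> t.
have t0 : t != 0 by near: t; exact: nbhs_dnbhs_neq.
have -> : (c \o shift 0) t%:A = c t by congr c; rewrite /shift addr0 [t%:A]mulr1.
rewrite {1}/c (mulmxA A^T) (mulmx1C AA) mul1mx.
by rewrite E addrAC subrr add0r (scalerA t^-1 t) mulVf // scale1r.
Unshelve. all: by end_near. Qed.

Lemma sphere_tangent_orthogonal (R : realType) m (b u : 'rV[R]_m.+1) :
  tangent (sphere R m) b u -> \sum_j b 0 j * u 0 j = 0.
Proof.
pose F (x : 'rV[R]_m.+1) : 'M[R]_1 := x *m x^T.
have CF k : Ck k setT F.
  apply: Ck_mulmx; first exact: openT.
    exact: (Ck_linear_mx k setT idfun).
  exact: (Ck_linear_mx k setT trmx).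
have dF : differentiable F b by have [+ _] := CF 1%N; exact.
move=> tu; have : 'd F b u = 0.
  apply: (diff_constant_on (a := 1%:M) dF) tu => x Sx.
  apply/matrixP => i j; rewrite !ord1 !mxE -[RHS]Sx.
  by apply: eq_bigr => k _; rewrite mxE expr2.
rewrite (@diff_quadratic _ _ _ F b u (u *m b^T + b *m u^T) (F u) dF).
  move/matrixP/(_ 0 0); rewrite !mxE => E.
  have {}E : \sum_j b 0 j * u 0 j + \sum_j b 0 j * u 0 j = 0.
    rewrite -[RHS]E; congr (_ + _); apply: eq_bigr => j _; rewrite mxE //.
    by rewrite mulrC.
  lra.
move=> h; rewrite /F.
have -> : (h *: u + b)^T = h *: u^T + b^T by apply/matrixP => i j; rewrite !mxE.
rewrite !mulmxDl !mulmxDr -!scalemxAl -!scalemxAr !scalerA -expr2 scalerDr.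
by rewrite [LHS](AC (2*2) (4*(2*3)*1)).
Qed.

(** * Reflections and connectedness *)

Section Reflection.
Variables (R : realType) (N : nat).
Implicit Types (a b c u v : 'cV[R]_N) (A C J : 'M[R]_N).

(* As [/ 0 = 0], this is the identity at [a = 0]. *)
Definition reflection a : 'M[R]_N := 1%:M - (2 / dot a a) *: (a *m a^T).

Lemma mul_reflection a u : reflection a *m u = u - (2 * dot a u / dot a a) *: a.
Proof.
rewrite mulmxBl mul1mx -scalemxAl -mulmxA trmx_mul_dot mul_mx_scalar scalerA.
by congr (_ - _ *: _); ring.
Qed.

Lemma reflectionT a : (reflection a)^T = reflection a.
Proof. by rewrite linearB linearZ /= trmx_mul trmxK trmx1. Qed.

Lemma reflection_fix a u : dot a u = 0 -> reflection a *m u = u.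
Proof. by move=> au; rewrite mul_reflection au mulr0 mul0r scale0r subr0. Qed.

Lemma reflectionK a : a != 0 -> reflection a *m reflection a = 1%:M.
Proof.
rewrite -dot_eq0 => a0.
rewrite {2}/reflection mulmxBr mulmx1 -scalemxAr mulmxA mul_reflection mulfK //.
rewrite scaler_nat mulr2n opprD addrA subrr sub0r mulNmx scalerN opprK.
by rewrite /reflection subrK.
Qed.

Lemma reflection_orthogonal a : a != 0 -> (reflection a)^T *m reflection a = 1%:M.
Proof. by move=> a0; rewrite reflectionT reflectionK. Qed.

Lemma reflection_swap u v : dot u u = dot v v -> u != v -> reflection (u - v) *m u = v.
Proof.
move=> uv; rewrite -subr_eq0 -dot_eq0 mul_reflection => nz.
suff -> : 2 * dot (u - v) u / dot (u - v) (u - v) = 1 by rewrite scale1r subKr.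
apply: (canLR (mulfK nz)); rewrite mul1r dotBl dotBr !dotBl uv (dotC u v); ring.
Qed.

(** Two block triangular factorizations of one block matrix are compared. The identity reduces the
    determinant of a reflection to a 1 by 1 determinant. *)
Lemma det_one_sub_mul m n (U : 'M[R]_(m, n)) (V : 'M[R]_(n, m)) :
  \det (1%:M - U *m V) = \det (1%:M - V *m U).
Proof.
have E1 : block_mx 1%:M U V 1%:M =
    block_mx 1%:M 0 V 1%:M *m block_mx 1%:M U 0 (1%:M - V *m U).
  rewrite mulmx_block !mul1mx !mulmx1 !mul0mx (addrC (V *m U)) subrK.
  by congr block_mx; rewrite ?(addr0 1%:M) ?(addr0 U) ?(addr0 V).
have E2 : block_mx 1%:M U V 1%:M =
    block_mx (1%:M - U *m V) U 0 1%:M *m block_mx 1%:M 0 V 1%:M.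
  rewrite mulmx_block !mul1mx !mulmx1 !mul0mx !mulmx0 subrK.
  by congr block_mx; rewrite ?(add0r 1%:M) ?(add0r U) ?(add0r V).
have := congr1 determinant E1; rewrite {1}E2 !det_mulmx det_lblock !det_ublock.
by rewrite !det1 !mul1r !mulr1.
Qed.

Lemma det_reflection a : a != 0 -> \det (reflection a) = -1.
Proof.
rewrite -dot_eq0 => a0; rewrite /reflection scalemxAr det_one_sub_mul -scalemxAl.
rewrite trmx_mul_dot scale_scalar_mx mulfVK // -raddfB det_scalar1 /=; ring.
Qed.

Lemma reflectionZ x a : x != 0 -> reflection (x *: a) = reflection a.
Proof.
move=> x0; have aT : (x *: a)^T = x *: a^T by rewrite linearZ.
rewrite /reflection dotZl dotZr aT -scalemxAl -scalemxAr !scalerA.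
congr (_ - _ *: _); have [->|a0] := eqVneq (dot a a) 0; first by rewrite !mulr0 invr0 mulr0 !mul0r.
by field; rewrite x0 a0.
Qed.

(** Join [a] to [b] by a segment. If it avoids 0, the reflections in its points form a path;
    otherwise [a] and [b] are proportional and define the same reflection. *)
Lemma reflection_path (D : set 'M[R]_N) C a b A : a != 0 -> b != 0 ->
  (forall s t, s *: a + t *: b != 0 -> D (C *m reflection (s *: a + t *: b) *m A)) ->
  connected_component D (C *m reflection a *m A) (C *m reflection b *m A).
Proof.
move=> a0 b0 DC.
have [[t t0]|nz] := pselect (exists t, (1 - t) *: a + t *: b = 0).
  have tn0 : t != 0.
    by apply: contraNneq a0 => tE; move: t0; rewrite tE subr0 scale1r scale0r addr0 => ->.
  have bE : b = (- (1 - t) / t) *: a.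
    rewrite mulrC -scalerA; apply: (canRL (scalerK tn0)); apply/eqP.
    by rewrite scaleNr -addr_eq0 addrC t0.
  have -> : reflection b = reflection a.
    rewrite bE reflectionZ //; apply: contraNneq b0 => tE.
    by rewrite bE tE scale0r.
  apply: connected_component_refl; have := DC 1 0.
  by rewrite scale1r scale0r addr0 a0 => /(_ isT).
pose f t := (1 - t) *: a + t *: b.
have f0 t : f t != 0 by apply/eqP => ft; apply: nz; exists t.
have Cf i : Ck 0 setT (fun t => f t i 0).
  apply: (@Ck_eq _ _ _ _ _ (fun t => ((a i 0)%:P + (b i 0 - a i 0) *: 'X).[t])) => //.
  - exact: openT.
  - by move=> t _; rewrite !mxE !hornerE; ring.
  - by move=> t _; exact: continuous_horner.
have CfM i j : Ck 0 setT (fun t => f t i 0 * f t j 0) by apply: CkM => //; exact: openT.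
have Cdot : Ck 0 setT (fun t => dot (f t) (f t)).
  apply: (@Ck_eq _ _ _ _ _ (fun t => \sum_i f t i 0 * f t i 0)) => //; first exact: openT.
    by move=> t _; rewrite dotE.
  by apply: Ck_sum => //; exact: openT.
have Cinv : Ck 0 setT (fun t => (dot (f t) (f t))^-1).
  by move=> t _; apply: cvgV; [rewrite dot_eq0|exact: Cdot].
have Crefl : Ck 0 setT (fun t => reflection (f t)).
  apply/(Ck_mxE _ _ openT) => i j.
  apply: (@Ck_eq _ _ _ _ _ (fun t => (1%:M : 'M[R]_N) i j +
     (-2) * ((dot (f t) (f t))^-1 * (f t i 0 * f t j 0)))) => //; first exact: openT.
    by move=> t _; rewrite /reflection !mxE big_ord1 !mxE; ring.
  apply: CkD; [exact: openT|exact: Ck_cst|].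
  apply: CkM; [exact: openT|exact: Ck_cst|].
  by apply: CkM; [exact: openT|exact: Cinv|exact: CfM].
have CF : Ck 0 setT (fun t => C *m reflection (f t) *m A).
  apply: Ck_mulmx; [exact: openT| |exact: Ck_cst].
  by apply: Ck_mulmx; [exact: openT|exact: Ck_cst|exact: Crefl].
exists (range (fun t => C *m reflection (f t) *m A)).
  split.
  - by exists 0 => //; rewrite /f subr0 scale1r scale0r addr0.
  - by move=> _ [t _ <-]; apply: DC; exact: f0.
  - apply: connected_continuous_connected.
      by apply/connected_intervalP => x y _ _ z _.
    by apply: continuous_subspaceT => t; exact: CF.
by exists 1 => //; rewrite /f subrr scale0r scale1r add0r.
Qed.

End Reflection.

(** * Rotations fixing given vectors, and the fibers *)

Section FiberConnected.
Variables (R : realType) (N : nat).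
Implicit Types (a b c u v p e : 'cV[R]_N) (A C J : 'M[R]_N) (P : 'cV[R]_N -> Prop).

Definition fixing_rotations P : set 'M[R]_N :=
  [set C | [/\ C^T *m C = 1%:M, \det C = 1 & forall x, P x -> C *m x = x]].

Definition reflection_product (s : seq 'cV[R]_N) : 'M[R]_N :=
  foldr (fun a M => reflection a *m M) 1%:M s.

(* If C moves x, the reflection in C x - x brings C x back to x, and it fixes every
   vector that C fixes. *)
Lemma orthogonal_reflection_product P C : C^T *m C = 1%:M ->
  (forall x, P x -> C *m x = x) ->
  exists2 s, C = reflection_product s &
    forall a, a \in s -> a != 0 /\ forall x, P x -> dot a x = 0.
Proof.
move=> CC CP.
(* Induction on [j], with the first N - j basis vectors already fixed: this is no condition for
   [j = N], and forces [D] to be the identity for [j = 0]. *)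
suff main j D : D^T *m D = 1%:M -> (forall x, P x -> D *m x = x) ->
    (forall i : 'I_N, (i + j < N)%N -> D *m delta_mx i 0 = delta_mx i 0 :> 'cV_N) ->
    exists2 s, D = reflection_product s &
      forall a, a \in s -> a != 0 /\ forall x, P x -> dot a x = 0.
  by apply: (main N) => // i; rewrite ltnNge leq_addl.
elim: j D => [|j IH] D DD DP De.
  exists [::] => //=; apply/matrixP => k i.
  have := De i; rewrite addn0 ltn_ord => /(_ isT)/matrixP/(_ k 0).
  by rewrite -colE !mxE eqxx andbT.
have [jN|Nj] := ltnP j N; last first.
  by apply: IH => // i ij; exfalso; lia.
have iP : (N - j.+1 < N)%N by lia.
pose x : 'cV[R]_N := delta_mx (Ordinal iP) 0.
have De' (D' : 'M[R]_N) : D' *m x = x ->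
    (forall i : 'I_N, (i + j.+1 < N)%N -> D' *m delta_mx i 0 = delta_mx i 0 :> 'cV_N) ->
    forall i : 'I_N, (i + j < N)%N -> D' *m delta_mx i 0 = delta_mx i 0 :> 'cV_N.
  move=> Dx Di i ij; have [/Di//|ij'] := ltnP (i + j.+1) N.
  suff -> : i = Ordinal iP by [].
  by apply: val_inj => /=; lia.
have [Dx|Dx] := eqVneq (D *m x) x; first by apply: IH => //; exact: De'.
pose a := D *m x - x; have a0 : a != 0 by rewrite subr_eq0.
have ay (y : 'cV_N) : D *m y = y -> dot a y = 0.
  by move=> Dy; rewrite dotBl -{1}Dy dot_orthogonal // subrr.
have fixed (y : 'cV_N) : D *m y = y -> (reflection a *m D) *m y = y.
  by move=> Dy; rewrite -mulmxA Dy reflection_fix // ay.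
have [||i ij|s sE sP] := IH (reflection a *m D).
- by rewrite trmx_mul -mulmxA (mulmxA _^T (reflection a)) reflection_orthogonal // mul1mx.
- by move=> y /DP/fixed.
- apply: De' ij => [|k kj]; last exact/fixed/De.
  by rewrite -mulmxA reflection_swap // dot_orthogonal.
exists (a :: s); first by rewrite /= -sE mulmxA reflectionK // mul1mx.
move=> b; rewrite inE => /predU1P[->|/sP//].
by split=> // y /DP/ay.
Qed.

Lemma det_reflection_product s : (forall a, a \in s -> a != 0) ->
  \det (reflection_product s) = (-1) ^+ size s.
Proof.
elim: s => [|a s IH] sP /=; first by rewrite det1 expr0.
rewrite det_mulmx det_reflection ?sP ?mem_head // exprS IH // => b bs.
by apply: sP; rewrite inE bs orbT.
Qed.

Lemma fixing_rotations_refl2 P a b C : a != 0 -> b != 0 ->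
  (forall x, P x -> dot a x = 0) -> (forall x, P x -> dot b x = 0) ->
  fixing_rotations P C -> fixing_rotations P (reflection a *m reflection b *m C).
Proof.
move=> a0 b0 aP bP [CC dC CP]; split.
- rewrite !trmx_mul -!mulmxA (mulmxA _ (reflection a)) reflection_orthogonal // mul1mx.
  by rewrite (mulmxA _ (reflection b)) reflection_orthogonal // mul1mx.
- by rewrite !det_mulmx !det_reflection // dC; ring.
- by move=> x Px; rewrite -!mulmxA CP // !reflection_fix ?aP ?bP.
Qed.

(** Determinant 1 makes the number of reflections even, and they are removed in pairs: the second
    vector of a pair is moved to the first through vectors orthogonal to all of [P], where the pair
    becomes the identity. *)
Lemma fixing_rotations_connected P : connected (fixing_rotations P).
Proof.
have F1 : fixing_rotations P 1%:M.
  by split; [rewrite trmx1 mulmx1|exact: det1|move=> x _; rewrite mul1mx].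
suff comp C : fixing_rotations P C -> connected_component (fixing_rotations P) C 1%:M.
  rewrite (_ : fixing_rotations P = connected_component (fixing_rotations P) 1%:M).
    exact: component_connected.
  apply/seteqP; split=> [C FC|]; last exact: connected_component_sub.
  exact/connected_component_sym/comp.
move=> [CC dC CP]; have [s sE sP] := orthogonal_reflection_product CC CP.
have : (-1 : R) ^+ size s = 1.
  by rewrite -det_reflection_product -?sE // => a /sP[].
rewrite -signr_odd; case sodd: (odd (size s)); first by rewrite expr1; clear => ?; lra.
move=> _.
have {sodd} sz : size s = (size s)./2.*2 by rewrite -[LHS]odd_double_half sodd.
rewrite {}sE {CC dC CP C}; move: (size s)./2 sz => k sz.
elim: k s sP sz => [|k IH] s sP.
  by move=> /size0nil -> /=; exact: connected_component_refl.
rewrite doubleS; case: s sP => [|a [|b s]] // sP [sz].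
have [a0 aP] := sP a (mem_head _ _).
have [b0 bP] : b != 0 /\ forall x, P x -> dot b x = 0.
  by apply: sP; rewrite !inE eqxx orbT.
have {}IH : connected_component (fixing_rotations P) (reflection_product s) 1%:M.
  by apply: IH => // c cs; apply: sP; rewrite !inE cs !orbT.
have Fs : fixing_rotations P (reflection_product s).
  by apply: connected_component_sub (connected_component_sym IH).
apply: connected_component_trans IH.
rewrite /= mulmxA -[X in connected_component _ _ X]mul1mx -(reflectionK a0).
apply: (reflection_path b0 a0) => x y xy0.
apply: fixing_rotations_refl2 => // z Pz.
by rewrite dotDl !dotZl ?aP ?bP // !mulr0 addr0.
Qed.

Section ComplexStructure.
Variable J : 'M[R]_N.
Hypotheses (JT : J^T = - J) (JJ : J *m J = - 1%:M).

Let JTJ : J^T *m J = 1%:M.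
Proof. by rewrite JT mulNmx JJ opprK. Qed.

Let dotJ u v : dot (J *m u) (J *m v) = dot u v.
Proof. exact: dot_orthogonal. Qed.

Let dot_uJu u : dot u (J *m u) = 0.
Proof. exact: dot_skew_diag. Qed.

Let J_eq0 u : (J *m u == 0) = (u == 0).
Proof. by rewrite -!dot_eq0 dotJ. Qed.

Let mul_J_reflection a : J *m reflection a = reflection (J *m a) *m J.
Proof.
rewrite mulmxBr mulmxBl mulmx1 mul1mx -scalemxAr -scalemxAl dotJ trmx_mul.
by rewrite -!mulmxA JTJ mulmx1.
Qed.

Let reflection2J a : a != 0 -> reflection a *m reflection (J *m a) =
  1%:M - (2 / dot a a) *: (a *m a^T + (J *m a) *m (J *m a)^T).
Proof.
move=> a0; rewrite {2}/reflection dotJ mulmxBr mulmx1 -scalemxAr mulmxA.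
rewrite (reflection_fix (dot_uJu a)) /reflection scalerDr.
by rewrite opprD addrA.
Qed.

(* On the complex line spanned by [a], reflecting in [a] and in [J a] is [- 1], so the
   product below is a rotation of this complex line. *)
Lemma reflection2_commute a c x y : a != 0 -> c != 0 -> c = x *: a + y *: (J *m a) ->
  J *m (reflection a *m reflection c) = reflection a *m reflection c *m J.
Proof.
move=> a0 c0 cE.
have Jc : J *m c = x *: (J *m a) - y *: a.
  by rewrite cE mulmxDr -!scalemxAr mulmxA JJ mulNmx mul1mx scalerN.
have aa0 : dot a a != 0 by rewrite dot_eq0.
have ccE : dot c c = (x ^+ 2 + y ^+ 2) * dot a a.
  rewrite cE !(dotDl, dotDr, dotZl, dotZr) dotJ dot_uJu (dotC (J *m a) a) dot_uJu; ring.
have cc0 : dot c c != 0 by rewrite dot_eq0.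
have xy0 : x ^+ 2 + y ^+ 2 != 0 by apply: contraNneq cc0 => xy; rewrite ccE xy mul0r.
have PcE : c *m c^T + (J *m c) *m (J *m c)^T =
    (x ^+ 2 + y ^+ 2) *: (a *m a^T + (J *m a) *m (J *m a)^T).
  rewrite Jc cE; set b := J *m a.
  apply/matrixP => i j; rewrite !mxE !big_ord1 !mxE; ring.
(* This product depends only on the complex line, which [a] and [c] share. It follows that the
   reflections in [J *m a] and [J *m c] have the same product as those in [a] and [c]. *)
have rho : reflection a *m reflection (J *m a) = reflection c *m reflection (J *m c).
  rewrite !reflection2J // PcE scalerA ccE; congr (_ - _ *: _).
  by field; rewrite aa0 xy0.
have Ja0 : J *m a != 0 by rewrite J_eq0.
have Jc0 : J *m c != 0 by rewrite J_eq0.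
rewrite mulmxA mul_J_reflection -mulmxA mul_J_reflection !mulmxA; congr (_ *m J).
have E1 : reflection (J *m a) = reflection a *m (reflection c *m reflection (J *m c)).
  by rewrite -rho mulmxA reflectionK // mul1mx.
by rewrite E1 -!mulmxA reflectionK // mulmx1.
Qed.

Variables (e v : 'cV[R]_N).
Hypothesis e_unit : dot e e = 1.

Let F := [set A : 'M[R]_N | SO R N A /\ A *m v = J *m A *m e].

Let F_unitary a c x y A : a != 0 -> c != 0 -> c = x *: a + y *: (J *m a) ->
  F A -> F (reflection a *m reflection c *m A).
Proof.
move=> a0 c0 cE [[AA dA] Av]; split; first split.
- rewrite !trmx_mul !reflectionT -!mulmxA (mulmxA A) AA mul1mx.
  by rewrite (mulmxA (reflection c)) reflectionK // mul1mx reflectionK.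
- by rewrite !det_mulmx !det_reflection // dA; ring.
- by rewrite -mulmxA Av !mulmxA -(reflection2_commute a0 c0 cE) !mulmxA.
Qed.

(** The equation of the fiber makes [A] and [A0] agree on [v] too, so [A *m A0^T] fixes [A0 *m e]
    and [A0 *m v]. Right translation by [A0] carries the connected set of such rotations into
    [F]. *)
Let F_same_image A0 A : F A0 -> F A -> A *m e = A0 *m e -> connected_component F A A0.
Proof.
move=> [[AA0 dA0] A0v] [[AA dA] Av] Ae.
pose P x := x = A0 *m e \/ x = A0 *m v.
have A0A0 := mulmx1C AA0.
exists ((fun C => C *m A0) @` fixing_rotations P).
  split.
  - exists (A *m A0^T); last by rewrite -mulmxA A0A0 mulmx1.
    split.
    + by rewrite trmx_mul trmxK -mulmxA (mulmxA A^T) (mulmx1C AA) mul1mx.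
    + by rewrite det_mulmx det_tr dA dA0 mulr1.
    + move=> x [->|->]; rewrite -mulmxA (mulmxA A0^T) A0A0 mul1mx //.
      by rewrite Av A0v -!mulmxA Ae.
  - move=> _ [C [CC dC CP] <-]; split; first split.
    + by rewrite trmx_mul -mulmxA (mulmxA A0) AA0 mul1mx; exact: mulmx1C.
    + by rewrite det_mulmx dC dA0 mulr1.
    + by rewrite -mulmxA CP; [rewrite A0v -!mulmxA (CP (A0 *m e)) //; left|right].
  - apply: connected_continuous_connected; first exact: fixing_rotations_connected.
    apply: continuous_subspaceT => C.
    have CC : Ck 0 setT (fun C => C *m A0).
      apply: Ck_mulmx; [exact: openT| |exact: Ck_cst].
      exact: (Ck_linear_mx 0 setT idfun).
    exact: CC.
exists 1%:M; last by rewrite mul1mx.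
by split; [rewrite trmx1 mulmx1|exact: det1|move=> x _; rewrite mul1mx].
Qed.

Lemma fiber_connected : connected F.
Proof.
have [[A0 FA0]|none] := pselect (exists A, F A); last first.
  rewrite (_ : F = set0); first exact: connected0.
  by apply/seteqP; split => // A FA; case: none; exists A.
suff comp A : F A -> connected_component F A A0.
  rewrite (_ : F = connected_component F A0); first exact: component_connected.
  apply/seteqP; split=> [A FA|]; last exact: connected_component_sub.
  exact/connected_component_sym/comp.
move=> FA; pose u := A *m e; pose p := A0 *m e.
have [up|up] := eqVneq u p; first exact: F_same_image.
have unit B : F B -> dot (B *m e) (B *m e) = 1.
  by move=> [[BB _] _]; rewrite dot_orthogonal //; exact: mulmx1C.
pose a := u - p; have a0 : a != 0 by rewrite subr_eq0.
(* The coefficients make [b] a vector of the complex line of [a] orthogonal to [u]. The reflection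
   in [b] fixes [u], and the one in [a] then takes [u] to [p]. *)
pose x := dot (J *m a) u; pose y := - dot a u.
pose b := x *: a + y *: (J *m a).
have au : dot a u != 0.
  apply: contraNneq a0 => au; rewrite -dot_eq0.
  move: au; rewrite /a !(dotBl, dotBr) !unit // (dotC p u) => ?; apply/eqP; lra.
have bu : dot b u = 0 by rewrite dotDl !dotZl /x /y; ring.
have b0 : b != 0.
  apply/eqP => /(congr1 (dot (J *m a))).
  have -> : dot (J *m a) 0 = 0 by rewrite /dot mulmx0 mxE.
  rewrite dotDr !dotZr dotJ dotC dot_uJu mulr0 add0r => /eqP.
  by rewrite mulf_eq0 dot_eq0 (negbTE a0) orbF /y oppr_eq0 (negbTE au).
pose A1 := reflection a *m reflection b *m A.
have FA1 : F A1 by apply: (@F_unitary a b x y).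
have A1e : A1 *m e = A0 *m e.
  rewrite /A1 -!mulmxA (reflection_fix bu) reflection_swap //.
  by rewrite !unit.
apply: connected_component_trans (F_same_image FA0 FA1 A1e).
apply: connected_component_sym.
(* [A] is [A1] with [b] replaced by [a]; moving [b] to [a] inside the complex line stays in [F]. *)
rewrite -[X in connected_component _ _ X]mul1mx -(reflectionK a0).
apply: (reflection_path b0 a0) => s t st0.
apply: (@F_unitary _ _ (s * x + t) (s * y)) => //.
by rewrite /b scalerDr !scalerA scalerDl addrAC.
Qed.

End ComplexStructure.
End FiberConnected.

(** * The submersion *)

Lemma exists_orthogonal (R : realType) N (p q : 'cV[R]_N) : (2 < N)%N ->
  exists c : 'cV[R]_N, [/\ c != 0, dot c p = 0 & dot c q = 0].
Proof.
move=> N2; have : kermx (row_mx p q) != 0.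
  rewrite -mxrank_eq0 mxrank_ker -lt0n subn_gt0.
  exact: leq_ltn_trans (rank_leq_col _) N2.
move=> /rowV0Pn[r /sub_kermxP + r0].
rewrite mul_mx_row -row_mx0 => /eq_row_mx[rp rq].
by exists r^T; rewrite /dot trmxK rp rq !mxE trmx_eq0.
Qed.

Section Pad.
Variables (R : realType) (m : nat).
Implicit Types (u : 'rV[R]_m.+1) (w : 'cV[R]_m.+2).

Definition e0 : 'cV[R]_m.+2 := delta_mx 0 0.

(** With [unpad], identifies R^(m+1) with the hyperplane orthogonal to [e0] in R^(m+2). *)
Definition pad u : 'cV[R]_m.+2 := \col_i (if unlift 0 i is Some j then u 0 j else 0).

Definition unpad w : 'rV[R]_m.+1 := \row_j w (lift 0 j) 0.

Lemma padK : cancel pad unpad.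
Proof. by move=> u; apply/rowP => j; rewrite !mxE liftK. Qed.

Lemma dot_e0 w : dot e0 w = w 0 0.
Proof. exact: dot_delta. Qed.

Lemma e0_unit : dot e0 e0 = 1.
Proof. by rewrite dot_e0 mxE. Qed.

Lemma dot_e0_pad u : dot e0 (pad u) = 0.
Proof. by rewrite dot_e0 mxE unlift_none. Qed.

Lemma unpadK w : dot e0 w = 0 -> pad (unpad w) = w.
Proof.
rewrite dot_e0 => w0; apply/colP => i; rewrite mxE.
by case: unliftP => [j|] -> //; rewrite mxE.
Qed.

Lemma dot_pad u w : dot (pad u) w = \sum_j u 0 j * unpad w 0 j.
Proof.
rewrite dotE big_ord_recl mxE unlift_none mul0r add0r.
by apply: eq_bigr => j _; rewrite !mxE liftK.
Qed.

Definition col0 (Z : 'M[R]_m.+2) : 'rV[R]_m.+1 := unpad (Z *m e0).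

Lemma col0_is_linear : linear col0.
Proof.
move=> a X Y; rewrite /col0 mulmxDl -scalemxAl.
by apply/rowP => j; rewrite !mxE.
Qed.

HB.instance Definition _ := GRing.isLinear.Build _ _ _ _ col0 col0_is_linear.

Lemma dot_pad2 u u' : dot (pad u) (pad u') = \sum_j u 0 j * u' 0 j.
Proof. by rewrite dot_pad padK. Qed.

End Pad.
Arguments e0 {R m}.

Section Commutator.
Variables (R : realType) (N : nat) (k : 'M[R]_N).
Hypothesis k_sqr : k *m k = - 1%:M.
Implicit Types W Y : 'M[R]_N.

Lemma commutator_anticommutes W :
  k *m (k *m W - W *m k) = - ((k *m W - W *m k) *m k).
Proof.
rewrite mulmxBr mulmxBl opprB mulmxA k_sqr -(mulmxA W) k_sqr.
by rewrite mulNmx mulmxN mul1mx mulmx1 mulmxA.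
Qed.

(** By anticommutation [k, [k, W]] = - 2 [k, W] k, and [k, W] k sends [e] to [w]. *)
Lemma double_commutator_mul W (e w : 'cV[R]_N) : W *m e = w -> W *m (k *m e) = 0 ->
  (k *m (k *m W - W *m k) - (k *m W - W *m k) *m k) *m e = - w - w.
Proof.
move=> We Wke; suff Hke : (k *m W - W *m k) *m k *m e = w.
  by rewrite commutator_anticommutes mulmxBl mulNmx Hke.
rewrite -mulmxA mulmxBl -!mulmxA Wke mulmx0 (mulmxA k k) k_sqr mulNmx mul1mx.
by rewrite mulmxN We opprK add0r.
Qed.

Lemma trace_commutator W Y :
  \tr ((k *m W - W *m k) *m Y) = - \tr (W *m (k *m Y - Y *m k)).
Proof.
have trB (A B : 'M[R]_N) : \tr (A - B) = \tr A - \tr B by rewrite linearB.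
rewrite mulmxBl mulmxBr !trB opprB -!mulmxA; congr (_ - _).
by rewrite mxtrace_mulC !mulmxA.
Qed.

End Commutator.

Section Submersion.
Variables (R : realType) (m : nat) (J : 'M[R]_m.+2).
Hypotheses (m_gt0 : (0 < m)%N) (JT : J^T = - J) (JJ : J *m J = - 1%:M).

Local Notation M := (SO R m.+2).
Local Notation S := (sphere R m).

Let K (A : 'M[R]_m.+2) := A^T *m J *m A.

Definition submersion (A : 'M[R]_m.+2) : 'rV[R]_m.+1 := col0 (K A).
Local Notation f := submersion.

Let KT A : (K A)^T = - K A.
Proof. by rewrite !trmx_mul trmxK JT mulNmx mulmxN mulmxA. Qed.

Let AK A : M A -> A *m K A = J *m A.
Proof. by move=> [AA _]; rewrite !mulmxA AA mul1mx. Qed.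

Let KA A : M A -> K A *m A^T = A^T *m J.
Proof. by move=> [AA _]; rewrite -mulmxA AA mulmx1. Qed.

Let KK A : M A -> K A *m K A = - 1%:M.
Proof.
move=> MA; rewrite {1}/K -mulmxA AK // -mulmxA (mulmxA J) JJ mulNmx mul1mx mulmxN.
by rewrite mulmx1C //; case: MA.
Qed.

Let K_orthogonal A : M A -> (K A)^T *m K A = 1%:M.
Proof. by move=> MA; rewrite KT mulNmx KK // opprK. Qed.

Let dot_e0_skew (Z : 'M[R]_m.+2) : Z^T = - Z -> dot e0 (Z *m e0) = 0.
Proof. exact: dot_skew_diag. Qed.

Let Ck_submersion k : Ck k setT f.
Proof.
have -> : f = @col0 R m \o K by [].
apply: Ck_comp_linear; first exact: openT.
  exact: linear_mx_continuous.
exact: Ck_congruence.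
Qed.

Let smooth_submersion A : smooth_near A f.
Proof. by apply: smooth_near_global => k; exact: Ck_submersion. Qed.

Let commutator A (Y : 'M[R]_m.+2) := K A *m Y - Y *m K A.

Let commutator_skew A Y : Y^T = - Y -> (commutator A Y)^T = - commutator A Y.
Proof.
move=> Ys; rewrite linearB /= (trmx_mul (K A) Y) (trmx_mul Y (K A)) KT Ys !mulNmx !mulmxN !opprK.
by rewrite opprB.
Qed.

Let commutatorB A X Y : commutator A (X - Y) = commutator A X - commutator A Y.
Proof. by rewrite /commutator mulmxBr mulmxBl !opprD !opprK addrACA. Qed.

Let diff_submersion A Y : Y^T = - Y -> 'd f A (A *m Y) = col0 (commutator A Y).
Proof.
move=> Ys; have dK : differentiable K A.
  by have [+ _] := Ck_congruence J 1; exact.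
have cL := @linear_mx_continuous _ _ _ _ (@col0 R m).
have -> : f = @col0 R m \o K by [].
rewrite diff_comp //; last exact: linear_differentiable.
rewrite /= diff_lin // diff_congruence trmx_mul Ys; congr col0.
by rewrite /commutator /K !mulNmx addrC !mulmxA.
Qed.

Let sphere_pad (b : 'rV[R]_m.+1) : S b <-> dot (pad b) (pad b) = 1.
Proof.
rewrite dot_pad padK /sphere /=.
by under eq_bigr do rewrite expr2.
Qed.

Let pad_submersion A : pad (f A) = K A *m e0.
Proof. by rewrite unpadK // dot_e0_skew. Qed.

Let submersion_sphere A : M A -> S (f A).
Proof.
move=> MA; apply/sphere_pad; rewrite pad_submersion dot_orthogonal ?e0_unit //.
exact: K_orthogonal.
Qed.

Let fiberE b A : M A -> (f A = b <-> A *m pad b = J *m A *m e0).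
Proof.
move=> MA; have [AA _] := MA; split=> [<-|Ab].
  by rewrite pad_submersion mulmxA AK.
apply: (can_inj (@padK R m)); rewrite pad_submersion -!mulmxA (mulmxA J) -Ab.
by rewrite mulmxA (mulmx1C AA) mul1mx.
Qed.

Let connected_fibers b : connected (M `&` f @^-1` [set b]).
Proof.
rewrite (_ : _ `&` _ = [set A | M A /\ A *m pad b = J *m A *m e0]).
  exact: (fiber_connected JT JJ (@e0_unit R m)).
by apply/seteqP; split => A [MA /(fiberE b MA) ?].
Qed.

(** By [fiberE] a rotation fixing [e0] and sending [v] to [J *m e0] lies over [b]. The reflection in
    [v - w] does both; a second reflection, in a vector orthogonal to [e0] and [w], restores
    determinant 1. *)
Let surjective_submersion : set_surj M S f.
Proof.
move=> b /sphere_pad bb; pose v := pad b; pose w := J *m e0.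
have ww : dot w w = 1 by rewrite dot_orthogonal ?e0_unit // JT mulNmx JJ opprK.
have e0w : dot w e0 = 0 by rewrite dotC dot_skew_diag.
have e0v : dot v e0 = 0 by rewrite dotC dot_e0_pad.
suff [A [MA Ae Av]] : exists A, [/\ M A, A *m e0 = e0 & A *m v = w].
  by exists A => //; apply/(fiberE b MA); rewrite -mulmxA Ae.
have [vw|vw] := eqVneq v w.
  exists 1%:M; rewrite !mul1mx; split => //.
  by split; [rewrite trmx1 mulmx1|exact: det1].
have [c [c0 ce cw]] := exists_orthogonal e0 w (m_gt0 : (2 < m.+2)%N).
have vw0 : v - w != 0 by rewrite subr_eq0.
exists (reflection c *m reflection (v - w)); split.
- split; last by rewrite det_mulmx !det_reflection //; ring.
  rewrite trmx_mul !reflectionT mulmxA -(mulmxA (reflection c)) reflectionK //.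
  by rewrite mulmx1 reflectionK.
- rewrite -mulmxA (_ : reflection (v - w) *m e0 = e0); first exact: reflection_fix.
  by apply: reflection_fix; rewrite dotBl e0v e0w subrr.
- rewrite -mulmxA (_ : reflection (v - w) *m v = w); first exact: reflection_fix.
  by apply: reflection_swap; rewrite // bb ww.
Qed.


Let wedge (w : 'cV[R]_m.+2) : 'M[R]_m.+2 := w *m e0^T - e0 *m w^T.

(* The skew matrix X such that A *m X is the horizontal lift of u at A. *)
Let lift_skew A (u : 'rV[R]_m.+1) := commutator A (wedge (- 2^-1 *: pad u)).

Let wedge_mul w x : wedge w *m x = dot e0 x *: w - dot w x *: e0 :> 'cV_m.+2.
Proof. by rewrite /wedge mulmxBl -!mulmxA !trmx_mul_dot !mul_mx_scalar. Qed.

Let wedge_skew w : (wedge w)^T = - wedge w.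
Proof. by rewrite linearB /= !trmx_mul !trmxK opprB. Qed.

Let lift_skew_skew A u : (lift_skew A u)^T = - lift_skew A u.
Proof. exact/commutator_skew/wedge_skew. Qed.

Let lift_skew_anti A u : M A -> K A *m lift_skew A u = - (lift_skew A u *m K A).
Proof.
by move=> MA; apply: commutator_anticommutes; exact: KK.
Qed.

Let col0_commutator_lift A (u : 'rV[R]_m.+1) : M A -> \sum_j u 0 j * f A 0 j = 0 ->
  col0 (commutator A (lift_skew A u)) = u.
Proof.
(* The factor -1/2 cancels the -2 of the double commutator. *)
move=> MA uf; set w := - 2^-1 *: pad u.
have we : dot w e0 = 0 by rewrite dotZl dotC dot_e0_pad mulr0.
have wv : dot w (K A *m e0) = 0.
  by rewrite dotZl -pad_submersion dot_pad padK uf mulr0.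
have wedge_e0 : wedge w *m e0 = w.
  by rewrite wedge_mul we e0_unit scale1r scale0r subr0.
have wedge_v : wedge w *m (K A *m e0) = 0.
  by rewrite wedge_mul wv dot_e0_skew // !scale0r subr0.
rewrite /col0 (double_commutator_mul (KK MA) wedge_e0 wedge_v).
rewrite -[RHS]padK; congr unpad.
by rewrite /w !scaleNr opprK -scalerDl -div1r -splitr scale1r.
Qed.

(** For the trace form the lift is adjoint to the differential: bracketing with [K A] is skew and
    moves onto [Y], and pairing with the wedge extracts the first column. *)
Let trace_lift A (u : 'rV[R]_m.+1) Y : Y^T = - Y ->
  \tr ((lift_skew A u)^T *m Y) = \sum_j u 0 j * col0 (commutator A Y) 0 j.
Proof.
move=> Ys; rewrite -dot_pad.
rewrite lift_skew_skew mulNmx linearN /= trace_commutator opprK.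
have Zs := commutator_skew A Ys; rewrite -/(commutator A Y) /col0.
move: (commutator A Y) Zs => Z Zs; set w := _ *: _.
have tr11 (x y : 'cV[R]_m.+2) : \tr (x *m y^T *m Z) = dot y (Z *m x).
  by rewrite -mulmxA mxtrace_mulC -mulmxA trmx_mul_dot mxtrace_scalar.
rewrite /wedge mulmxBl linearB /= !tr11 [dot e0 _]dotC (dot_skew _ _ Zs) /w dotZl.
lra.
Qed.

Variable g : 'M[R]_m.+2 -> 'M[R]_m.+2 -> 'M[R]_m.+2 -> R.
Hypotheses (g_metric : riemannian_metric M g) (g_bi : bi_invariant g).

Let tangent1 (X : 'M[R]_m.+2) : X^T = - X -> tangent M 1%:M X.
Proof.
move=> Xs; rewrite -[X]mul1mx; apply: tangent_SO => //.
by split; [rewrite trmx1 mulmx1|exact: det1].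
Qed.

Let M1 : M 1%:M.
Proof. by split; [rewrite trmx1 mulmx1|exact: det1]. Qed.

Let tangent_map_linear (L : {linear 'M[R]_m.+2 -> 'M[R]_m.+2}) A X :
  tangent M A X -> tangent_map M L A X = L X.
Proof.
move=> tX; rewrite tangent_mapE //.
  by rewrite diff_lin //; exact: linear_mx_continuous.
by apply: smooth_near_global => k; exact: Ck_linear_mx.
Qed.

Let g_left A X Y : M A -> X^T = - X -> Y^T = - Y -> g A (A *m X) (A *m Y) = g 1%:M X Y.
Proof.
move=> MA Xs Ys; have [left_inv _] := g_bi MA.
have := left_inv 1%:M X Y M1 (tangent1 Xs) (tangent1 Ys).
rewrite -/(mulmx A) (tangent_map_linear (mulmx A) (tangent1 Xs)).
by rewrite (tangent_map_linear (mulmx A) (tangent1 Ys)) /= mulmx1.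
Qed.

(** Right translation by [A^T] brings tangent vectors at [A] back to the identity; combined with
    left invariance it gives invariance under the adjoint action. *)
Let g_conj A X Y : M A -> X^T = - X -> Y^T = - Y ->
  g 1%:M (A *m X *m A^T) (A *m Y *m A^T) = g 1%:M X Y.
Proof.
move=> MA Xs Ys; have [AA dA] := MA.
have MAT : M A^T by split; [rewrite trmxK; exact: mulmx1C|rewrite det_tr].
have [_ right_inv] := g_bi MAT.
have tX := tangent_SO MA Xs; have tY := tangent_SO MA Ys.
have := right_inv A _ _ MA tX tY.
rewrite -/(mulmxr A^T) (tangent_map_linear (mulmxr A^T) tX).
by rewrite (tangent_map_linear (mulmxr A^T) tY) /= AA g_left.
Qed.

(** This projection extends the metric at the identity, meaningful on skew matrices only, to a
    bilinear form on all matrices. *)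
Let skew_part (X : 'M[R]_m.+2) : 'M[R]_m.+2 := 2^-1 *: (X - X^T).

Let skew_part_skew X : (skew_part X)^T = - skew_part X.
Proof. by rewrite linearZ linearB /= trmxK -scalerN opprB. Qed.

Let skew_partE X : X^T = - X -> skew_part X = X.
Proof. by move=> Xs; rewrite /skew_part Xs opprK scalerDr -scalerDl -div1r -splitr scale1r. Qed.

Let skew_part_linear a X Y : skew_part (a *: X + Y) = a *: skew_part X + skew_part Y.
Proof.
have tE : (a *: X + Y)^T = a *: X^T + Y^T by rewrite linearD linearZ.
by apply/matrixP => i j; rewrite /skew_part tE !mxE; ring.
Qed.

Let skew_part_conj O X : skew_part (O *m X *m O^T) = O *m skew_part X *m O^T.
Proof.
by rewrite /skew_part -scalemxAr -scalemxAl mulmxBr mulmxBl !trmx_mul trmxK !mulmxA.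
Qed.

(** The conclusion of [unitary_invariant_form], assumed here for [J] in dimension m + 2 instead of
    the block form in dimension n + n. *)
Hypothesis invariant_form : forall B : 'M[R]_m.+2 -> 'M[R]_m.+2 -> R,
  (forall a X X' Y, B (a *: X + X') Y = a * B X Y + B X' Y) ->
  (forall X Y, B X Y = B Y X) ->
  (forall O, O *m O^T = 1%:M -> \det O = 1 ->
    forall X Y, B (O *m X *m O^T) (O *m Y *m O^T) = B X Y) ->
  exists k, forall X Y, X^T = - X -> J *m X = - (X *m J) -> Y^T = - Y ->
    B X Y = k * \tr (X^T *m Y).

(** Conjugation by [A] turns [K A] into [J], so the conjugated lift anticommutes with [J] and the
    invariant form theorem applies, with one constant for all [A]. *)
Let metric_lift : exists k, forall A (u : 'rV[R]_m.+1) Y, M A -> Y^T = - Y ->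
  g A (A *m lift_skew A u) (A *m Y) = k * \sum_j u 0 j * col0 (commutator A Y) 0 j.
Proof.
pose B X Y := g 1%:M (skew_part X) (skew_part Y).
have [| | |k kB] := invariant_form (B := B).
- move=> a X X' Y; rewrite /B skew_part_linear (metric_linear g_metric) //;
    exact/tangent1/skew_part_skew.
- by move=> X Y; apply: (Defs.metric_sym g_metric) => //; exact/tangent1/skew_part_skew.
- by move=> O OO dO X Y; rewrite /B !skew_part_conj g_conj.
exists k => A u Y MA Ys; rewrite -trace_lift //.
have [AA dA] := MA; have ATA := mulmx1C AA.
have Hs := lift_skew_skew A u; have Ha := lift_skew_anti u MA.
move: (lift_skew A u) Hs Ha => H Hs Ha.
have conj_skew (X : 'M[R]_m.+2) : X^T = - X -> (A *m X *m A^T)^T = - (A *m X *m A^T).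
  by move=> Xs; rewrite !trmx_mul trmxK Xs mulNmx mulmxN mulmxA.
rewrite g_left // -(g_conj MA) //.
have := kB (A *m H *m A^T) (A *m Y *m A^T) (conj_skew _ Hs).
rewrite /B !skew_partE; do ?exact: conj_skew.
move=> ->; last exact: conj_skew.
- have conjM : A *m H *m A^T *m (A *m Y *m A^T) = A *m (H *m Y) *m A^T.
    by rewrite !mulmxA -(mulmxA _ A^T A) ATA mulmx1.
  have trN (Z : 'M[R]_m.+2) : \tr (- Z) = - \tr Z by rewrite linearN.
  rewrite conj_skew // Hs (mulNmx (A *m H *m A^T)) (mulNmx H) conjM !trN.
  by rewrite mxtrace_mulC (mulmxA A^T) ATA mul1mx.
- rewrite -(mulmxA A H) mulmxA -(AK MA) -(mulmxA A (K A)) (mulmxA (K A)) Ha.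
  by rewrite mulNmx mulmxN -(mulmxA H) (KA MA) !mulmxA.
Qed.

Theorem exists_submersion : exists h,
  riemannian_metric S h /\ riemannian_submersion M g S h f.
Proof.
have [k kE] := metric_lift.
have tmE A Y : M A -> Y^T = - Y -> tangent_map M f A (A *m Y) = col0 (commutator A Y).
  move=> MA Ys; rewrite tangent_mapE //; first exact: diff_submersion.
  exact: tangent_SO.
have tangentE A U : M A -> tangent M A U -> exists2 X, X^T = - X & U = A *m X.
  move=> MA tU; have UE : U = A *m (A^T *m U) by rewrite mulmxA (proj1 MA) mul1mx.
  by exists (A^T *m U) => //; apply: (@SO_tangent_skew _ _ A) => //; rewrite -UE.
have lift_tm A (u : 'rV[R]_m.+1) : M A -> \sum_j u 0 j * f A 0 j = 0 ->
    tangent_map M f A (A *m lift_skew A u) = u.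
  by move=> MA uf; rewrite tmE // col0_commutator_lift.
have lift_horizontal A (u : 'rV[R]_m.+1) : M A -> horizontal M g f A (A *m lift_skew A u).
  move=> MA; split; first exact: tangent_SO.
  move=> _ /(tangentE _ _ MA)[Y Ys ->]; rewrite tmE // kE // => ->.
  by rewrite big1 ?mulr0 // => j _; rewrite mxE mulr0.
have image_orthogonal A Y : M A -> Y^T = - Y ->
    \sum_j col0 (commutator A Y) 0 j * f A 0 j = 0.
  move=> MA Ys; rewrite -[f A]padK pad_submersion -dot_pad.
  rewrite unpadK; last exact/dot_e0_skew/commutator_skew.
  rewrite /commutator mulmxBl dotBl -(mulmxA (K A) Y) -(mulmxA Y (K A)).
  rewrite (dot_orthogonal _ _ (K_orthogonal MA)).
  by rewrite dotC dot_skew_diag // dotC dot_skew_diag // subrr.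
(* The difference between [U] and the lift of its image is both horizontal and vertical, hence
   orthogonal to itself and zero. *)
have horizontalE A U : M A -> horizontal M g f A U ->
    U = A *m lift_skew A (tangent_map M f A U).
  move=> MA [tU Uh]; have [X Xs UE] := tangentE _ _ MA tU.
  set u := tangent_map M f A U.
  have uE : u = col0 (commutator A X) by rewrite /u UE tmE.
  have uf : \sum_j u 0 j * f A 0 j = 0 by rewrite uE image_orthogonal.
  pose H := lift_skew A u; have Hs : H^T = - H by exact: lift_skew_skew.
  have Ds : (X - H)^T = - (X - H) by rewrite linearB /= Xs Hs -opprD.
  have tD : tangent M A (A *m (X - H)) by exact: tangent_SO.
  have vD : tangent_map M f A (A *m (X - H)) = 0.
    by rewrite tmE // commutatorB linearB /= -uE col0_commutator_lift // subrr.
  have [_ Hh] := lift_horizontal A u MA.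
  have gD : g A (A *m (X - H)) (A *m (X - H)) = 0.
    have tN : tangent M A (- 1 *: (A *m H) + A *m X).
      by rewrite scaleN1r addrC -(mulmxBr A X H).
    rewrite {1}(mulmxBr A X H) addrC -scaleN1r (metric_linear g_metric) //; try exact: tangent_SO.
    by rewrite Hh // -UE Uh // mulr0 addr0.
  apply/eqP; rewrite -subr_eq0 UE -(mulmxBr A X H); apply/negPn/negP => D0.
  by have := metric_pos g_metric MA tD D0; rewrite gD ltxx.
(* Evaluate the metric on the lift of a nonzero vector orthogonal to [e0] and [K 1%:M *m e0]; such a
   vector exists because the dimension exceeds 2. *)
have k_gt0 : 0 < k.
  have [c [c0 ce cK]] := exists_orthogonal e0 (K 1%:M *m e0) (m_gt0 : (2 < m.+2)%N).
  pose u := unpad c; have uc : pad u = c by rewrite unpadK // dotC.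
  have uf : \sum_j u 0 j * f 1%:M 0 j = 0 by rewrite -[f _]padK pad_submersion -dot_pad uc.
  have H0 : 1%:M *m lift_skew 1%:M u != 0.
    rewrite mul1mx; apply: contraNneq c0 => H0.
    rewrite -uc -(col0_commutator_lift M1 uf) H0 /commutator mulmx0 mul0mx subrr linear0.
    by apply/eqP/colP => i; rewrite !mxE; case: unlift => // j; rewrite mxE.
  have := metric_pos g_metric M1 (tangent_SO M1 (lift_skew_skew _ u)) H0.
  rewrite kE // col0_commutator_lift // -dot_pad2 uc.
  by rewrite pmulr_lgt0 // dot_gt0.
(* The Euclidean metric scaled by [k], as [metric_lift] dictates. *)
exists (fun _ u v : 'rV[R]_m.+1 => k * \sum_j u 0 j * v 0 j); split.
  split.
  - by move=> p u v _ _ _; congr (_ * _); apply: eq_bigr => j _; rewrite mulrC.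
  - move=> p a u u' v _ _ _ _; rewrite mulrCA -mulrDr; congr (_ * _).
    by rewrite mulr_sumr -big_split; apply: eq_bigr => j _; rewrite !mxE /=; ring.
  - move=> p u _ _ u0; rewrite mulr_gt0 // -dot_pad2 dot_gt0.
    by apply: contraNneq u0 => pu; rewrite -[u]padK pu; apply/eqP/rowP => j; rewrite !mxE.
  - move=> X Y [sX _] [sY _] p Sp.
    have [F [[U [oU Up CF]] FX]] := sX p Sp; have [G [[U' [oU' Up' CG]] GY]] := sY p Sp.
    exists (fun q => k * \sum_j F q 0 j * G q 0 j); split.
      exists (U `&` U'); split=> // [|i]; first exact: openI.
      have oI : open (U `&` U') by exact: openI.
      apply: CkM; [by []|exact: Ck_cst|].
      apply: Ck_sum => // j; apply: CkM => //.
        exact: (proj1 (Ck_mxE _ _ oI) (Ck_sub (@subIsetl _ _ _) (CF i))).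
      exact: (proj1 (Ck_mxE _ _ oI) (Ck_sub (@subIsetr _ _ _) (CG i))).
    by apply: filterS2 FX GY => q Fq Gq Sq; rewrite Fq // Gq.
have sphere_orthogonal A (u : 'rV[R]_m.+1) : tangent S (f A) u -> \sum_j u 0 j * f A 0 j = 0.
  by move=> /sphere_tangent_orthogonal fu; rewrite -[RHS]fu; apply: eq_bigr => j _; rewrite mulrC.
split.
- by move=> A MA; exact: submersion_sphere.
- by move=> A MA; exists f; split; [exact: smooth_submersion|near=> x].
- exact: surjective_submersion.
- move=> A MA u /sphere_orthogonal uf; exists (A *m lift_skew A u); last exact: lift_tm.
  exact: tangent_SO.
- move=> A U V MA hU hV; rewrite [in RHS](horizontalE A U MA hU).
  have [tV _] := hV; have [Y Ys VE] := tangentE _ _ MA tV.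
  by rewrite VE kE // tmE.
- move=> A MA u /sphere_orthogonal uf; exists (A *m lift_skew A u); last exact: lift_tm.
  exact: lift_horizontal.
- by move=> b _; exact: connected_fibers.
Unshelve. all: by end_near. Qed.

End Submersion.

Theorem theorem4p1 (R : realType) (n : nat) (hn : (2 <= n)%N)
    (g : 'M[R]_(2 * n) -> 'M[R]_(2 * n) -> 'M[R]_(2 * n) -> R)
    (hg : riemannian_metric (SO R (2 * n)) g)
    (hbi : bi_invariant g) :
  exists (h : 'rV[R]_(2 * n - 2).+1 -> 'rV[R]_(2 * n - 2).+1 ->
              'rV[R]_(2 * n - 2).+1 -> R)
         (f : 'M[R]_(2 * n) -> 'rV[R]_(2 * n - 2).+1),
    riemannian_metric (sphere R (2 * n - 2)) h /\
    riemannian_submersion (SO R (2 * n)) g (sphere R (2 * n - 2)) h f.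
Proof.
have [J [JT JJ formJ]] : exists J : 'M[R]_(2 * n), [/\ J^T = - J, J *m J = - 1%:M &
    forall B : 'M[R]_(2 * n) -> 'M[R]_(2 * n) -> R,
    (forall a X X' Y, B (a *: X + X') Y = a * B X Y + B X' Y) ->
    (forall X Y, B X Y = B Y X) ->
    (forall O, O *m O^T = 1%:M -> \det O = 1 ->
      forall X Y, B (O *m X *m O^T) (O *m Y *m O^T) = B X Y) ->
    exists k, forall X Y, X^T = - X -> J *m X = - (X *m J) -> Y^T = - Y ->
      B X Y = k * \tr (X^T *m Y)].
  rewrite mul2n -addnn; exists (block_complex_structure R n).
  split; [exact: block_complex_structureT|exact: block_complex_structure_sqr|].
  by move=> B Bl Bs Binv; exact: unitary_invariant_form.
(* This is where [hn] enters: the ambient dimension m + 2 must exceed 2. *)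
have m_gt0 : (0 < 2 * n - 2)%N by lia.
have : (2 * n = (2 * n - 2).+2)%N by lia.
move: (2 * n - 2)%N m_gt0 => m m_gt0.
move: (2 * n)%N g hg hbi J JT JJ formJ => N g hg hbi J JT JJ formJ EN.
subst N; have [h fh] := exists_submersion m_gt0 JT JJ hg hbi formJ.
by exists h, (submersion J).
Qed.
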